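(* (1) Let $(G,(X,e),\Theta:X\to G,G')$ be a relaxed augmented Lie rack, let $\mathfrak{g},\mathfrak{g}'$ be the Lie algebras of $G,G'$ (so $\mathfrak g'\subset\mathfrak g$), and let $V:=T_eX$. Give $V$ the structure of a $\mathfrak{g}$-module via the differential at $e\in X$ of the action of $G$ on $X$; explicitly, for $a\in\mathfrak{g}$ and $v\in V$, $$a\cdot v=\left.\frac{d}{dt}T_eL_{a(t)}(v)\right|_{t=0},$$ where $t\mapsto a(t)\in G$, $t\in[-1,1]$, is any smooth curve with $a(0)=e_G$ and $\frac{da}{dt}(0)=a$, and $L_g:X\to X$ denotes the action of $g\in G$ on $X$. Let $\theta=d\Theta=T_e\Theta:V\to\mathfrak{g}$ be the differential of $\Theta$ at $e$. Then $(\mathfrak{g},V,\theta,\mathfrak{g}')$ is a relaxed augmented Leibniz algebra. (It is called the tangent relaxed augmented Leibniz algebra of $(G,(X,e),\Theta,G')$.) (2) For $i=1,2$ let $(G_i,(X_i,e_i),\Theta_i:X_i\to G_i,G_i')$ be a relaxed augmented Lie rack, with underlying Lie group-rack triple $(G_i,X_i,\Theta_i)$ and tangent relaxed augmented Leibniz algebra $(\mathfrak{g}_i,V_i,\theta_i,\mathfrak{g}_i')$ as constructed in (1). Let $(\Phi,\Psi):(G_1,X_1,\Theta_1)\to(G_2,X_2,\Theta_2)$ be a morphism of Lie group-rack triples. Then $(\varphi,\psi):=(T_{e_{G_1}}\Phi,\,T_{e_1}\Psi)$ is a morphism of Lie-Leibniz triples $(\mathfrak{g}_1,V_1,\theta_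1)\to(\mathfrak{g}_2,V_2,\theta_2)$.
   Context: All manifolds and Lie groups are finite-dimensional (real, smooth). $e_G$ denotes the unit element of a group $G$. **Relaxed augmented Lie rack.** A tuple $(G,(X,e),\Theta,G')$ where $G$ is a Lie group acting smoothly on a smooth manifold $X$ with a distinguished point $e\in X$ satisfying $g\cdot e=e$ for all $g\in G$, $\Theta:X\to G$ is a smooth map, and $G'\subset G$ is a Lie subgroup containing $\mathrm{Im}(\Theta)$, such that $\Theta(e)=e_G$ and $\Theta(g\cdot x)=g\Theta(x)g^{-1}$ for all $g\in G'$ and all $x\in X$. **Lie rack.** A rack is a set $X$ with a binary operation $\triangleright$ such that $x\triangleright(y\triangleright z)=(x\triangleright y)\triangleright(x\triangleright z)$ for all $x,y,z$ and each map $x\triangleright-:X\to X$ is bijective. It is pointed by $e\in X$ if $e\triangleright x=x$ and $x\triangleright e=e$ for all $x$. A Lie rack is a pointed rack $(X,\triangleright,e)$ with $X$ a smooth manifold and $\triangleright$ smooth. **Lie group-rack triple.** A triple $(G,X,\Theta)$ where $G$ is a Lie group, $(X,\triangleright,e)$ is a Lie rack on which $G$ acts smoothly, and $\Theta:X\to G$ is a smooth map with $\Theta(e)=e_G$ such that $x\triangleright y=\Theta(x)\cdot y$ and $\Theta(x\triangleright y)=\Theta(x)\Theta(y)\Theta(x)^{-1}$ for all $x,y\in X$. A relaxed augmented Lie rack $(G,(X,e),\Theta,G')$ has an underlying Lie group-rack triple $(G,X,\Theta)$ with $x\triangleright y:=\Theta(x)\cdot y$. **Morphism of Lie group-rack triples**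 $(G_1,X_1,\Theta_1)\to(G_2,X_2,\Theta_2)$: a pair $(\Phi,\Psi)$ where $\Phi:G_1\to G_2$ is a morphism of Lie groups and $\Psi:X_1\to X_2$ is a smooth map such that $\Psi(e_1)=e_2$ (distinguished points), $\Theta_2(\Psi(x))=\Phi(\Theta_1(x))$ and $\Psi(g\cdot x)=\Phi(g)\cdot\Psi(x)$ for all $g\in G_1$, $x\in X_1$. **Relaxed augmented Leibniz algebra.** A tuple $(\mathfrak{g},V,\theta,\mathfrak{g}')$ where $\mathfrak{g}$ is a Lie algebra acting on a vector space $V$, $\theta:V\to\mathfrak{g}$ is a linear map, and $\mathfrak{g}'\subset\mathfrak{g}$ is a Lie subalgebra containing $\mathrm{Im}(\theta)$, such that $\theta(g\cdot v)=[g,\theta(v)]_{\mathfrak{g}}$ for all $g\in\mathfrak{g}'$ and all $v\in V$. **Lie-Leibniz triple.** A triple $(\mathfrak{g},V,\theta)$ where $(\mathfrak{g},[,]_{\mathfrak g})$ is a Lie algebra, $(V,[,])$ is a Leibniz algebra (a vector space with a bilinear bracket with $[u,[v,w]]=[[u,v],w]+[v,[u,w]]$) which is also a $\mathfrak{g}$-module, and $\theta:V\to\mathfrak{g}$ is a linear map with $[u,v]=\theta(u)\cdot v$ and $\theta([u,v])=[\theta(u),\theta(v)]_{\mathfrak{g}}$ for all $u,v\in V$. A relaxed augmented Leibniz algebra $(\mathfrak{g},V,\theta,\mathfrak{g}')$ gives a Lie-Leibniz triple $(\mathfrak{g},V,\theta)$ with bracket $[u,v]:=\theta(u)\cdot v$.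 **Morphism of Lie-Leibniz triples** $(\mathfrak{g}_1,V_1,\theta_1)\to(\mathfrak{g}_2,V_2,\theta_2)$: a pair $(\varphi,\psi)$ with $\varphi:\mathfrak{g}_1\to\mathfrak{g}_2$ a Lie algebra morphism and $\psi:V_1\to V_2$ a linear map such that $\theta_2(\psi(v))=\varphi(\theta_1(v))$ and $\psi(a\cdot v)=\varphi(a)\cdot\psi(v)$ for all $a\in\mathfrak{g}_1$, $v\in V_1$. *)

(* Defs.v *)
From HB Require Import structures.
From mathcomp Require Import all_boot all_order all_algebra.
From mathcomp Require Import all_classical all_reals all_analysis.

Set Implicit Arguments.
Unset Strict Implicit.
Unset Printing Implicit Defensive.

Import Order.TTheory GRing.Theory Num.Theory.
Import numFieldNormedType.Exports.

Local Open Scope classical_set_scope.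
Local Open Scope ring_scope.

(** * Smooth maps between normed spaces *)

(** [Ck_on k A f]: [f] is of class C^k on the set [A], which is meant to be
    open. The recursion goes through directional derivatives, which for a
    finite-dimensional source is the usual notion. *)
Fixpoint Ck_on (R : realType) (E F : normedModType R) (k : nat) (A : set E)
    (f : E -> F) : Prop :=
  match k with
  | 0%N => forall x, A x -> {for x, continuous f}
  | k'.+1 => (forall x, A x -> differentiable f x) /\
             forall v : E, Ck_on k' A (fun x => 'd f x v)
  end.

Definition smooth_on (R : realType) (E F : normedModType R) (A : set E)
  (f : E -> F) : Prop := forall k, Ck_on k A f.

(** * Manifolds *)

(** A homeomorphism from the open set [chart_dom] of [M] to the open set
    [chart_to @` chart_dom] of R^n; [chart_to] and [chart_from] are total
    functions whose values outside these sets are irrelevant. *)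
Record chart (R : realType) (n : nat) (M : topologicalType) := Chart {
  chart_dom : set M;
  chart_to : M -> 'rV[R]_n;
  chart_from : 'rV[R]_n -> M;
  chart_dom_open : open chart_dom;
  chart_cod_open : open (chart_to @` chart_dom);
  chart_toK : forall x, chart_dom x -> chart_from (chart_to x) = x;
  chart_to_continuous : forall x, chart_dom x -> {for x, continuous chart_to};
  chart_from_continuous : forall u, (chart_to @` chart_dom) u ->
    {for u, continuous chart_from} }.

(** Smooth n-dimensional manifolds: Hausdorff, second countable, with a smooth
    atlas. The preferred chart [chart_at x] around [x] is only used to give
    coordinates on the tangent space at [x]. *)
HB.mixin Record Topological_isManifold (R : realType) (n : nat) M
    of Topological M := {
  manifold_hausdorff : hausdorff_space M;
  manifold_second_countable : @second_countable M;
  atlas : set (chart R n M);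
  atlas_compatible : forall c d, atlas c -> atlas d ->
    smooth_on (chart_to c @` (chart_dom c `&` chart_dom d))
      (chart_to d \o chart_from c);
  chart_at : M -> chart R n M;
  chart_at_atlas : forall x, atlas (chart_at x);
  chart_at_dom : forall x, chart_dom (chart_at x) x }.

#[short(type="manifoldType")]
HB.structure Definition Manifold (R : realType) (n : nat) :=
  { M of Topological M & Topological_isManifold R n M }.

Definition smooth (R : realType) (m n : nat) (M : manifoldType R m)
    (N : manifoldType R n) (f : M -> N) : Prop :=
  continuous f /\
  forall (c : chart R m M) (d : chart R n N), atlas c -> atlas d ->
    smooth_on (chart_to c @` (chart_dom c `&` f @^-1` chart_dom d))
      (chart_to d \o f \o chart_from c).

(** Smoothness of a map from a product M x N, in the product charts. *)
Definition smooth2 (R : realType) (m n p : nat) (M : manifoldType R m)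
    (N : manifoldType R n) (P : manifoldType R p) (f : M -> N -> P) : Prop :=
  continuous (fun z : M * N => f z.1 z.2) /\
  forall (c : chart R m M) (d : chart R n N) (k : chart R p P),
    atlas c -> atlas d -> atlas k ->
    smooth_on
      ((fun z : M * N => (chart_to c z.1, chart_to d z.2)) @`
         [set z | [/\ chart_dom c z.1, chart_dom d z.2
                    & chart_dom k (f z.1 z.2)]])
      (fun u : 'rV[R]_m * 'rV[R]_n =>
         chart_to k (f (chart_from c u.1) (chart_from d u.2))).

(** Smoothness of a parametrized curve on an open set [A] of parameters. *)
Definition smooth_curve_on (R : realType) (n : nat) (M : manifoldType R n)
    (A : set R) (c : R -> M) : Prop :=
  (forall t, A t -> {for t, continuous c}) /\
  forall d : chart R n M, atlas d ->
    smooth_on (A `&` c @^-1` chart_dom d) (chart_to d \o c : R^o -> 'rV[R]_n).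

(** * Tangent spaces and tangent maps *)

(** T_x M, identified with R^n by the preferred chart at [x]. *)
Definition tangent_space (R : realType) (n : nat) (M : manifoldType R n)
  (x : M) : normedModType R := 'rV[R]_n.

Definition tangent_map (R : realType) (m n : nat) (M : manifoldType R m)
    (N : manifoldType R n) (f : M -> N) (x : M) :
    tangent_space x -> tangent_space (f x) :=
  'd (chart_to (chart_at (f x)) \o f \o chart_from (chart_at x) :
        'rV[R]_m -> 'rV[R]_n)
    (chart_to (chart_at x) x).
Arguments tangent_map {R m n M N} f x _.

Definition velocity (R : realType) (n : nat) (M : manifoldType R n)
    (c : R -> M) (t : R) : tangent_space (c t) :=
  derive1 (chart_to (chart_at (c t)) \o c : R -> 'rV[R]_n) t.

Definition vector_field (R : realType) (n : nat) (M : manifoldType R n) :=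
  forall x : M, tangent_space x.

(** The vector field [V] read in the preferred chart at [x]: at the point of
    coordinates [u], the tangent vector is moved from the preferred chart at
    that point to the one at [x]. *)
Definition field_in_chart (R : realType) (n : nat) (M : manifoldType R n)
    (V : vector_field M) (x : M) (u : 'rV[R]_n) : 'rV[R]_n :=
  let y := chart_from (chart_at x) u in
  'd (chart_to (chart_at x) \o chart_from (chart_at y) : 'rV[R]_n -> 'rV[R]_n)
    (chart_to (chart_at y) y) (V y).

Definition vector_field_bracket (R : realType) (n : nat)
    (M : manifoldType R n) (V W : vector_field M) : vector_field M :=
  fun x =>
    let u := chart_to (chart_at x) x in
    let v := field_in_chart V x in
    let w := field_in_chart W x in
    'd w u (v u) - 'd v u (w u).

(** * Lie groups *)

HB.mixin Record Manifold_isLieGroup (R : realType) (n : nat) G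
    of Manifold R n G & Group G := {
  mulg_smooth : smooth2 (fun x y : G => (x * y)%g);
  invg_smooth : smooth (fun x : G => (x^-1)%g) }.

#[short(type="lieGroupType")]
HB.structure Definition LieGroup (R : realType) (n : nat) :=
  { G of Manifold R n G & Group G & Manifold_isLieGroup R n G }.

Definition lie_group_morphism (R : realType) (m n : nat)
    (G : lieGroupType R m) (H : lieGroupType R n) (f : G -> H) : Prop :=
  smooth f /\ {morph f : x y / (x * y)%g}.

(** The underlying vector space of the Lie algebra of [G]. *)
Definition lie_algebra (R : realType) (n : nat) (G : lieGroupType R n) :
  normedModType R := tangent_space (1%g : G).

Definition left_invariant_field (R : realType) (n : nat)
    (G : lieGroupType R n) (a : lie_algebra G) : vector_field G :=
  fun g => tangent_map (fun h : G => (g * h)%g) 1%g a.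

Definition lie_bracket (R : realType) (n : nat) (G : lieGroupType R n)
    (a b : lie_algebra G) : lie_algebra G :=
  vector_field_bracket (left_invariant_field a) (left_invariant_field b) 1%g.
Arguments lie_bracket {R n} G a b.

(** A Lie subgroup: the image of an injective immersive morphism of Lie groups
    (it need not be closed, nor carry the induced topology). *)
Record lie_subgroup (R : realType) (n : nat) (G : lieGroupType R n) :=
  LieSubgroup {
  subgroup_dim : nat;
  subgroup_type : lieGroupType R subgroup_dim;
  subgroup_incl : subgroup_type -> G;
  subgroup_incl_morphism : lie_group_morphism subgroup_incl;
  subgroup_incl_inj : injective subgroup_incl;
  subgroup_incl_immersion : forall h,
    injective (tangent_map subgroup_incl h) }.

Definition subgroup_set (R : realType) (n : nat) (G : lieGroupType R n)
  (H : lie_subgroup G) : set G := range (@subgroup_incl _ _ _ H).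

(** The Lie algebra of a Lie subgroup, as a subspace of that of the group. *)
Definition subgroup_lie_algebra (R : realType) (n : nat)
    (G : lieGroupType R n) (H : lie_subgroup G) : set (lie_algebra G) :=
  range (tangent_map (@subgroup_incl _ _ _ H) 1%g).

Record smooth_action (R : realType) (n p : nat) (G : lieGroupType R n)
    (X : manifoldType R p) (act : G -> X -> X) : Prop := SmoothAction {
  smooth_act : smooth2 act;
  act1x : forall x, act 1%g x = x;
  actMx : forall g h x, act (g * h)%g x = act g (act h x) }.

(** * Racks *)

Record relaxed_augmented_lie_rack (R : realType) (n p : nat)
    (G : lieGroupType R n) (X : manifoldType R p) (act : G -> X -> X) (e : X)
    (Theta : X -> G) (G' : lie_subgroup G) : Prop := RelaxedAugmentedLieRack {
  ralr_action : smooth_action act;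
  ralr_fix : forall g, act g e = e;
  ralr_smooth : smooth Theta;
  ralr_sub : forall x, subgroup_set G' (Theta x);
  ralr_point : Theta e = 1%g;
  ralr_equivariant : forall g x, subgroup_set G' g ->
    Theta (act g x) = (g * Theta x * g^-1)%g }.

Record lie_rack (R : realType) (p : nat) (X : manifoldType R p)
    (rk : X -> X -> X) (e : X) : Prop := LieRack {
  rack_distributive : forall x y z, rk x (rk y z) = rk (rk x y) (rk x z);
  rack_bijective : forall x, bijective (rk x);
  rack_pointl : forall x, rk e x = x;
  rack_pointr : forall x, rk x e = e;
  rack_smooth : smooth2 rk }.

Record lie_group_rack_triple (R : realType) (n p : nat)
    (G : lieGroupType R n) (X : manifoldType R p) (act : G -> X -> X)
    (rk : X -> X -> X) (e : X) (Theta : X -> G) : Prop := LieGroupRackTriple {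
  lgrt_rack : lie_rack rk e;
  lgrt_action : smooth_action act;
  lgrt_smooth : smooth Theta;
  lgrt_point : Theta e = 1%g;
  lgrt_rackE : forall x y, rk x y = act (Theta x) y;
  lgrt_anchor : forall x y,
    Theta (rk x y) = (Theta x * Theta y * (Theta x)^-1)%g }.

Definition rack_of_action (G X : Type) (act : G -> X -> X) (Theta : X -> G) :
  X -> X -> X := fun x y => act (Theta x) y.

Record lie_group_rack_triple_morphism (R : realType) (n1 p1 n2 p2 : nat)
    (G1 : lieGroupType R n1) (X1 : manifoldType R p1)
    (act1 : G1 -> X1 -> X1) (rk1 : X1 -> X1 -> X1) (e1 : X1)
    (Theta1 : X1 -> G1)
    (G2 : lieGroupType R n2) (X2 : manifoldType R p2)
    (act2 : G2 -> X2 -> X2) (rk2 : X2 -> X2 -> X2) (e2 : X2)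
    (Theta2 : X2 -> G2)
    (Phi : G1 -> G2) (Psi : X1 -> X2) : Prop := LieGroupRackTripleMorphism {
  lgrtm_source : lie_group_rack_triple act1 rk1 e1 Theta1;
  lgrtm_target : lie_group_rack_triple act2 rk2 e2 Theta2;
  lgrtm_group : lie_group_morphism Phi;
  lgrtm_smooth : smooth Psi;
  lgrtm_point : Psi e1 = e2;
  lgrtm_anchor : forall x, Theta2 (Psi x) = Phi (Theta1 x);
  lgrtm_equivariant : forall g x, Psi (act1 g x) = act2 (Phi g) (Psi x) }.

(** * Lie and Leibniz algebras *)

Record is_lie_algebra (R : realType) (g : lmodType R) (br : g -> g -> g) :
    Prop := IsLieAlgebra {
  lie_linearl : forall b, linear (br^~ b);
  lie_linearr : forall a, linear (br a);
  lie_alternating : forall a, br a a = 0;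
  lie_jacobi : forall a b c,
    br a (br b c) + br b (br c a) + br c (br a b) = 0 }.

Record is_lie_subalgebra (R : realType) (g : lmodType R) (br : g -> g -> g)
    (h : set g) : Prop := IsLieSubalgebra {
  subalgebra0 : h 0;
  subalgebraP : forall (r : R) a b, h a -> h b -> h (r *: a + b);
  subalgebra_br : forall a b, h a -> h b -> h (br a b) }.

Record is_lie_module (R : realType) (g : lmodType R) (br : g -> g -> g)
    (V : lmodType R) (act : g -> V -> V) : Prop := IsLieModule {
  module_linearl : forall v, linear (act^~ v);
  module_linearr : forall a, linear (act a);
  module_br : forall a b v,
    act (br a b) v = act a (act b v) - act b (act a v) }.

Record is_leibniz_algebra (R : realType) (V : lmodType R)
    (lb : V -> V -> V) : Prop := IsLeibnizAlgebra {
  leibniz_linearl : forall v, linear (lb^~ v);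
  leibniz_linearr : forall u, linear (lb u);
  leibniz_identity : forall u v w,
    lb u (lb v w) = lb (lb u v) w + lb v (lb u w) }.

Record relaxed_augmented_leibniz_algebra (R : realType) (g V : lmodType R)
    (br : g -> g -> g) (act : g -> V -> V) (theta : V -> g) (g' : set g) :
    Prop := RelaxedAugmentedLeibnizAlgebra {
  rala_lie : is_lie_algebra br;
  rala_module : is_lie_module br act;
  rala_linear : linear theta;
  rala_subalgebra : is_lie_subalgebra br g';
  rala_sub : forall v, g' (theta v);
  rala_equivariant : forall a v, g' a ->
    theta (act a v) = br a (theta v) }.

Record lie_leibniz_triple (R : realType) (g V : lmodType R)
    (br : g -> g -> g) (act : g -> V -> V) (lb : V -> V -> V)
    (theta : V -> g) : Prop := LieLeibnizTriple {
  llt_lie : is_lie_algebra br;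
  llt_leibniz : is_leibniz_algebra lb;
  llt_module : is_lie_module br act;
  llt_linear : linear theta;
  llt_bracketE : forall u v, lb u v = act (theta u) v;
  llt_anchor : forall u v, theta (lb u v) = br (theta u) (theta v) }.

Definition leibniz_of_action (g V : Type) (act : g -> V -> V)
  (theta : V -> g) : V -> V -> V := fun u v => act (theta u) v.

Record lie_leibniz_triple_morphism (R : realType) (g1 V1 g2 V2 : lmodType R)
    (br1 : g1 -> g1 -> g1) (act1 : g1 -> V1 -> V1) (lb1 : V1 -> V1 -> V1)
    (theta1 : V1 -> g1)
    (br2 : g2 -> g2 -> g2) (act2 : g2 -> V2 -> V2) (lb2 : V2 -> V2 -> V2)
    (theta2 : V2 -> g2)
    (phi : g1 -> g2) (psi : V1 -> V2) : Prop := LieLeibnizTripleMorphism {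
  lltm_source : lie_leibniz_triple br1 act1 lb1 theta1;
  lltm_target : lie_leibniz_triple br2 act2 lb2 theta2;
  lltm_lie_linear : linear phi;
  lltm_lie_br : {morph phi : a b / br1 a b >-> br2 a b};
  lltm_linear : linear psi;
  lltm_anchor : forall v, theta2 (psi v) = phi (theta1 v);
  lltm_equivariant : forall a v, psi (act1 a v) = act2 (phi a) (psi v) }.

Lemma relaxed_augmented_leibniz_triple (R : realType) (g V : lmodType R)
    (br : g -> g -> g) (act : g -> V -> V) (theta : V -> g) (g' : set g) :
  relaxed_augmented_leibniz_algebra br act theta g' ->
  lie_leibniz_triple br act (leibniz_of_action act theta) theta.
Proof.
case=> Hl Hm Ht Hs Hi He; split=> //; last first.
  by move=> u v; exact: He.
split.
- by move=> v r u w; rewrite /leibniz_of_action Ht (module_linearl Hm).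
- by move=> u; exact: (module_linearr Hm).
- move=> u v w; rewrite /leibniz_of_action He // (module_br Hm).
  by rewrite subrK.
Qed.

(** * The differential of a smooth action at a fixed point *)

(** The derivative at the unit, in the direction [a], of the map
    g |-> T_e L_g v. When [e] is fixed by [G], this map takes its values in
    the single vector space T_e X, since [chart_at (act g e)] is
    [chart_at e]. *)
Definition tangent_action (R : realType) (n p : nat) (G : lieGroupType R n)
    (X : manifoldType R p) (act : G -> X -> X) (e : X)
    (a : lie_algebra G) (v : tangent_space e) : tangent_space e :=
  'd (fun u : 'rV[R]_n =>
        tangent_map (act (chart_from (chart_at (1%g : G)) u)) e v : 'rV[R]_p)
    (chart_to (chart_at (1%g : G)) 1%g) a.
Arguments tangent_action {R n p G X} act e a v.

(** * The Lie group-rack triple underlying a relaxed augmented Lie rack *)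

Lemma near_is_diff (R : realType) (E F : normedModType R) (f g : E -> F)
    (df : E -> F) (x : E) :
  (\forall y \near x, f y = g y) -> is_diff x f df -> is_diff x g df.
Proof.
move=> fg [fd <-].
have gE : g \o shift x = cst (g x) + 'd f x +o_ 0 id.
  apply/eqaddoP => _ /posnumP[eps].
  have /eqaddoP/(_ _ (gt0 eps)) := diff_locally fd.
  have fg0 : \forall h \near (0 : E), f (h + x) = g (h + x).
    by move: fg; rewrite (near_shift 0) /= subr0; apply: filterS.
  have fgx := nbhs_singleton fg.
  apply: filter_app; near=> h.
  rewrite /= !fctE fgx.
  by have -> : f (h + x) = g (h + x) by near: h.
have gd := diff_unique (diff_continuous fd) gE.
split; last by [].
by apply/diff_locallyP; rewrite gd; split=> //; exact: diff_continuous.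
Unshelve. all: by end_near. Qed.

Lemma is_diffZf (R : realType) (E F : normedModType R) (a da : E -> R)
    (f df : E -> F) (x : E) :
  is_diff x (a : E -> R^o) (da : E -> R^o) -> is_diff x f df ->
  is_diff x (fun y => a y *: f y) (fun v => a x *: df v + da v *: f x).
Proof.
move=> ad fd.
have bil : bilinear_for (GRing.Scale.Law.clone _ _ *:%R _)
    (GRing.Scale.Law.clone _ _ *:%R _) (@GRing.scale R F : R^o -> F -> F).
  split=> [u'|u] c y z /=.
  - by rewrite scalerDl scalerA.
  - by rewrite scalerDr !scalerA mulrC.
pose bM := bilinear_isBilinear.Build R R^o F F _ _ (@GRing.scale R F) bil.
pose B : {bilinear R^o -> F -> F} := HB.pack (@GRing.scale R F) bM.
have Bc : continuous (fun p : R^o * F => B p.1 p.2).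
  by move=> p; exact: scale_continuous.
have pd := is_diff_pair ad fd.
have Bd : is_diff (a x : R^o, f x) (fun p : R^o * F => B p.1 p.2)
    (fun q => a x *: q.2 + q.1 *: f x).
  by split; [exact: differentiable_bilin | exact: diff_bilin].
exact: (is_diff_comp pd Bd).
Qed.

Section Ck.
Context {R : realType}.
Implicit Types E F H : normedModType R.

Lemma Ck_on_eq E F k (A : set E) (f g : E -> F) : open A ->
  (forall x, A x -> f x = g x) -> Ck_on k A f -> Ck_on k A g.
Proof.
move=> oA; elim: k f g => [|k IH] f g fg /=.
  move=> fc x Ax; have nfg : \forall y \near x, f y = g y.
    by apply: filterS (open_nbhs_nbhs (conj oA Ax)) => y; exact: fg.
  have fx : f @ x --> f x := fc x Ax; rewrite (fg x Ax) in fx.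
  by apply: cvg_trans fx; apply: near_eq_cvg; apply: filterS nfg.
have gd x : A x -> differentiable f x -> is_diff x g ('d f x).
  move=> Ax fd; apply: near_is_diff (differentiableP fd).
  by apply: filterS (open_nbhs_nbhs (conj oA Ax)) => y; exact: fg.
move=> [fd fk]; split=> [x Ax|v].
  by have [] := gd x Ax (fd x Ax).
apply: IH (fk v) => x Ax.
by have [_ ->] := gd x Ax (fd x Ax).
Qed.

Lemma Ck_onS_is_diff E F k (A : set E) (f : E -> F) (df : E -> E -> F) :
  open A -> (forall x, A x -> is_diff x f (df x)) ->
  (forall v, Ck_on k A (fun x => df x v)) -> Ck_on k.+1 A f.
Proof.
move=> oA fd fk; split=> [x Ax|v]; first by have [] := fd x Ax.
by apply: Ck_on_eq (fk v) => // x Ax; have [_ ->] := fd x Ax.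
Qed.

Lemma Ck_onW E F k (A : set E) (f : E -> F) : Ck_on k.+1 A f -> Ck_on k A f.
Proof.
elim: k f => [|k IH] f [fd fk].
  by move=> x Ax; apply: differentiable_continuous; exact: fd.
by split; [exact: fd | move=> v; apply: IH; exact: fk].
Qed.

Lemma Ck_on_pointwise E F k (A : set E) (f : E -> F) :
  (forall x, A x -> exists2 B : set E, B x & Ck_on k B f) -> Ck_on k A f.
Proof.
elim: k f => [|k IH] f fB.
  by move=> x Ax; have [B Bx fc] := fB x Ax; exact: (fc x Bx).
split=> [x Ax|v]; first by have [B Bx [fd _]] := fB x Ax; exact: (fd x Bx).
apply: IH => x Ax; have [B Bx [_ fk]] := fB x Ax; exists B => //; exact: fk.
Qed.

Lemma Ck_onS E F k (A B : set E) (f : E -> F) : A `<=` B ->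
  Ck_on k B f -> Ck_on k A f.
Proof. by move=> AB fB; apply: Ck_on_pointwise => x /AB Bx; exists B. Qed.

Lemma Ck_on_cst E F k (A : set E) (c : F) : open A ->
  Ck_on k A (fun=> c : F).
Proof.
move=> oA; elim: k c => [|k IH] c /=; first by move=> x _; exact: cst_continuous.
by apply: (@Ck_onS_is_diff _ _ _ _ _ (fun _ _ => 0)) => // x _; exact: is_diff_cst.
Qed.

Lemma Ck_on_linear E F H k (A : set E) (L : {linear F -> H}) (f : E -> F) :
  open A -> continuous L -> Ck_on k A f -> Ck_on k A (fun x => L (f x)).
Proof.
move=> oA Lc; elim: k f => [|k IH] f.
  by move=> fc x Ax; apply: continuous_comp; [exact: fc | exact: Lc].
move=> [fd fk].
apply: (@Ck_onS_is_diff _ _ _ _ _ (fun x v => L ('d f x v))) => [//|x Ax|v].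
  have Ld : is_diff (f x) L L.
    by split; [exact: linear_differentiable | exact: diff_lin].
  exact: (is_diff_comp (differentiableP (fd x Ax)) Ld).
exact: IH (fk v).
Qed.

Lemma Ck_onD E F k (A : set E) (f g : E -> F) : open A ->
  Ck_on k A f -> Ck_on k A g -> Ck_on k A (fun x => f x + g x).
Proof.
move=> oA; elim: k f g => [|k IH] f g.
  by move=> fc gc x Ax; apply: continuousD; [exact: fc | exact: gc].
move=> [fd fk] [gd gk].
apply: (@Ck_onS_is_diff _ _ _ _ _ (fun x v => 'd f x v + 'd g x v))
  => [//|x Ax|v]; last exact: IH (fk v) (gk v).
exact: (is_diffD (differentiableP (fd x Ax)) (differentiableP (gd x Ax))).
Qed.

Lemma Ck_on_sum E F k (A : set E) n (f : 'I_n -> E -> F) : open A ->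
  (forall i, Ck_on k A (f i)) -> Ck_on k A (fun x => \sum_i f i x).
Proof.
move=> oA; elim: n f => [|n IH] f fk.
  by apply: Ck_on_eq (Ck_on_cst k 0 oA) => // x _; rewrite big_ord0.
apply: (@Ck_on_eq _ _ _ _
  (fun x => f ord0 x + \sum_(i < n) f (lift ord0 i) x)) => //.
  by move=> x _; rewrite big_ord_recl.
by apply: Ck_onD => //; apply: IH.
Qed.

Lemma Ck_onZ E F k (A : set E) (a : E -> R) (f : E -> F) : open A ->
  Ck_on k A (a : E -> R^o) -> Ck_on k A f -> Ck_on k A (fun x => a x *: f x).
Proof.
move=> oA; elim: k a f => [|k IH] a f.
  by move=> ac fc x Ax; apply: cvgZ; [exact: ac | exact: fc].
move=> aS fS; have [ad ak] := aS; have [fd fk] := fS.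
apply: (@Ck_onS_is_diff _ _ _ _ _
  (fun x v => a x *: 'd f x v + 'd (a : E -> R^o) x v *: f x)) => [//|x Ax|v].
  exact: (is_diffZf (differentiableP (ad x Ax)) (differentiableP (fd x Ax))).
by apply: Ck_onD => //; [apply: IH (Ck_onW aS) (fk v) | apply: IH (ak v) (Ck_onW fS)].
Qed.

Definition findim F := exists n (b : 'I_n -> F) (l : 'I_n -> {linear F -> R^o}),
  (forall i, continuous (l i)) /\ forall w, w = \sum_i l i w *: b i.

Lemma Ck_on_comp E F H k (A : set E) (B : set F) (f : E -> F) (g : F -> H) :
  findim F -> open A -> open B -> (forall x, A x -> B (f x)) ->
  Ck_on k A f -> Ck_on k B g -> Ck_on k A (fun x => g (f x)).
Proof.
move=> [n [b [l [lc wE]]]] oA oB AB; elim: k g => [|k IH] g.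
  move=> fc gc x Ax; apply: continuous_comp; first exact: fc.
  exact/gc/AB.
move=> fS gS; have [fd fk] := fS; have [gd gk] := gS.
apply: (@Ck_onS_is_diff _ _ _ _ _
  (fun x v => \sum_i l i ('d f x v) *: 'd g (f x) (b i))) => [//|x Ax|v].
  have := is_diff_comp (differentiableP (fd x Ax))
    (differentiableP (gd _ (AB x Ax))).
  congr is_diff_def; apply/funext => v /=.
  rewrite [in LHS](wE ('d f x v)) linear_sum /=.
  by apply: eq_bigr => i _; rewrite linearZ.
apply: Ck_on_sum => // i; apply: Ck_onZ => //.
  exact: Ck_on_linear (fk v).
apply: (IH (fun y => 'd g y (b i))); last exact: gk.
exact: Ck_onW.
Qed.

Lemma Ck_on_pair E F H k (A : set E) (f : E -> F) (g : E -> H) :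
  open A -> Ck_on k A f -> Ck_on k A g -> Ck_on k A (fun x => (f x, g x)).
Proof.
move=> oA; elim: k f g => [|k IH] f g.
  by move=> fc gc x Ax; apply: cvg_pair; [exact: fc | exact: gc].
move=> [fd fk] [gd gk].
apply: (@Ck_onS_is_diff _ _ _ _ _ (fun x v => ('d f x v, 'd g x v)))
  => [//|x Ax|v]; last exact: IH (fk v) (gk v).
exact: (is_diff_pair (differentiableP (fd x Ax)) (differentiableP (gd x Ax))).
Qed.

Lemma linear_choice E F n (f : 'I_n -> E -> F) : (forall i, linear (f i)) ->
  exists p : 'I_n -> {linear E -> F}, forall i, p i = f i :> (E -> F).
Proof.
move=> flin; have pP i : exists p : {linear E -> F}, (p : E -> F) = f i.
  move: (f i) (flin i) => r rP.
  pose rM := GRing.isLinear.Build _ _ _ _ r rP.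
  by pose r' : {linear _ -> _} := HB.pack r rM; exists r'.
by have [p pE] := choice pP; exists p.
Qed.

Lemma findim_rV n : findim 'rV[R]_n.
Proof.
have [j c u v|l lE] := @linear_choice 'rV[R]_n R^o n (fun j w => w 0 j).
  by rewrite !mxE.
exists n, (fun j => delta_mx 0 j), l; split.
  by move=> j; rewrite lE; exact: coord_continuous.
by move=> w; under eq_bigr do rewrite lE; exact: row_sum_delta.
Qed.

Lemma findim_prod F H : findim F -> findim H -> findim (F * H)%type.
Proof.
move=> [n [b [l [lc wE]]]] [n' [b' [l' [lc' wE']]]].
pose q (j : 'I_(n + n')) (w : F * H) : R^o :=
  match fintype.split j with inl i => l i w.1 | inr i => l' i w.2 end.
have [j c u v|p pE] := @linear_choice (F * H)%type R^o (n + n') q.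
  by rewrite /q; case: (fintype.split j) => i /=; rewrite linearP.
exists (n + n')%N, (fun j => match fintype.split j with
  inl i => (b i, 0) | inr i => (0, b' i) end), p; split.
  move=> j; rewrite pE /q => w; case: (fintype.split j) => i.
    by apply: (@continuous_comp _ _ _ fst (l i)); [exact: cvg_fst | exact: lc].
  by apply: (@continuous_comp _ _ _ snd (l' i)); [exact: cvg_snd | exact: lc'].
have sumE m m' (f : 'I_m -> F) (h : 'I_m' -> H) :
    \sum_i (f i, 0 : H) + \sum_i (0 : F, h i) = (\sum_i f i, \sum_i h i).
  have add_pair (x x' : F) (y y' : H) : (x, y) + (x', y') = (x + x', y + y').
    by [].
  have -> : \sum_i (f i, 0 : H) = (\sum_i f i, 0).
    elim/big_rec2 : _ => // i x y _ ->; by rewrite add_pair addr0.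
  have -> : \sum_i (0 : F, h i) = (0, \sum_i h i).
    elim/big_rec2 : _ => // i x y _ ->; by rewrite add_pair addr0.
  by rewrite add_pair addr0 add0r.
move=> [w w']; rewrite [w in LHS]wE [w' in LHS]wE' -sumE big_split_ord /=.
congr (_ + _); apply: eq_bigr => i _; rewrite pE /q.
  rewrite -[lshift n' i]/(unsplit (inl i)) unsplitK.
  by rewrite -[RHS]/(_ , _) scaler0.
rewrite -[rshift n i]/(unsplit (inr i)) unsplitK.
by rewrite -[RHS]/(_ , _) scaler0.
Qed.

Lemma Ck_on_id E k (A : set E) : open A -> Ck_on k A (@id E).
Proof.
move=> oA; case: k => [|k]; first by move=> x _; exact: cvg_id.
apply: (@Ck_onS_is_diff _ _ _ _ _ (fun _ v => v)) => // v.
exact: Ck_on_cst.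
Qed.
End Ck.

Lemma open_setI_preimage (T U : topologicalType) (A : set T) (B : set U)
    (f : T -> U) : open A -> open B ->
  (forall x, A x -> {for x, continuous f}) -> open (A `&` f @^-1` B).
Proof.
move=> oA oB fc; rewrite openE => x [Ax Bfx].
rewrite /interior; apply: filterI; first exact: open_nbhs_nbhs.
exact: (fc x Ax) _ (open_nbhs_nbhs (conj oB Bfx)).
Qed.

Lemma chart_image_open (R : realType) n (M : topologicalType)
    (c : chart R n M) (U : set M) : open U ->
  open (chart_to c @` (chart_dom c `&` U)).
Proof.
move=> oU.
rewrite (_ : _ @` _ = chart_to c @` chart_dom c `&` chart_from c @^-1` U).
  apply: open_setI_preimage => //; first exact: chart_cod_open.
  exact: chart_from_continuous.
apply/seteqP; split=> [u [x [cx Ux] <-]|u [[x cx <-]]] /=.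
  by split; [exists x | rewrite chart_toK].
by rewrite chart_toK // => Ux; exists x.
Qed.

Lemma chart2_image_open (R : realType) m n (M N : topologicalType)
    (c : chart R m M) (d : chart R n N) (O : set (M * N)) : open O ->
  open ((fun z : M * N => (chart_to c z.1, chart_to d z.2)) @`
          [set z | [/\ chart_dom c z.1, chart_dom d z.2 & O z]]).
Proof.
move=> oO; pose A := chart_to c @` chart_dom c.
pose B := chart_to d @` chart_dom d.
pose f := fun u : 'rV[R]_m * 'rV[R]_n => (chart_from c u.1, chart_from d u.2).
rewrite (_ : _ @` _ = (A `*` B) `&` f @^-1` O).
  apply: open_setI_preimage => //.
    rewrite openE => u [Au Bu]; exists (A, B) => //=.
    by split; apply: open_nbhs_nbhs; split=> //; exact: chart_cod_open.
  move=> u [Au Bu]; apply: cvg_pair.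
    apply: (@continuous_comp _ _ _ fst (chart_from c)); first exact: cvg_fst.
    exact: chart_from_continuous.
  apply: (@continuous_comp _ _ _ snd (chart_from d)); first exact: cvg_snd.
  exact: chart_from_continuous.
apply/seteqP; split=> [u [[x y] /= [cx dy Oxy] <-]|[u v]] /=.
  by rewrite /f /= !chart_toK //; split=> //; split; [exists x | exists y].
move=> [[[x cx <-] [y dy <-]]]; rewrite /f /= !chart_toK // => Oxy.
by exists (x, y).
Qed.

Lemma smooth2_compl (R : realType) m n p q (M : manifoldType R m)
    (N : manifoldType R n) (P : manifoldType R p) (Q : manifoldType R q)
    (h : M -> Q) (f : Q -> N -> P) :
  smooth h -> smooth2 f -> smooth2 (fun x y => f (h x) y).
Proof.
move=> [hc hs] [fc fs]; split.
  move=> z; apply: (@continuous_comp _ _ _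
    (fun z : M * N => (h z.1, z.2)) (fun z : Q * N => f z.1 z.2)); last exact: fc.
  apply: cvg_pair; last exact: cvg_snd.
  by apply: (@continuous_comp _ _ _ fst h); [exact: cvg_fst | exact: hc].
move=> c d k ac ad ak r; apply: Ck_on_pointwise => _ [[x y] /= [cx dy kxy] <-].
pose e := chart_at (h x).
pose S1 := chart_to c @` (chart_dom c `&` h @^-1` chart_dom e).
pose S2 := (fun z : Q * N => (chart_to e z.1, chart_to d z.2)) @`
  [set z | [/\ chart_dom e z.1, chart_dom d z.2 & chart_dom k (f z.1 z.2)]].
pose T1 := [set u : 'rV[R]_m * 'rV[R]_n | S1 u.1].
pose g u : 'rV[R]_q * 'rV[R]_n := (chart_to e (h (chart_from c u.1)), u.2).
have oS1 : open S1.
  apply: chart_image_open; apply: open_comp (chart_dom_open _).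
  by move=> ? _; exact: hc.
have oS2 : open S2.
  have oO : open ((fun z : Q * N => f z.1 z.2) @^-1` chart_dom k).
    by apply: open_comp (chart_dom_open _) => ? _; exact: fc.
  exact: (@chart2_image_open _ _ _ _ _ e d _ oO).
have oT1 : open T1.
  by apply: (@open_comp _ _ fst) oS1 => ? _; exact: cvg_fst.
have fstc : continuous (@fst 'rV[R]_m 'rV[R]_n) by move=> z; exact: cvg_fst.
have sndc : continuous (@snd 'rV[R]_m 'rV[R]_n) by move=> z; exact: cvg_snd.
have gs j : Ck_on j T1 g.
  have idk := Ck_on_id j oT1.
  apply: Ck_on_pair => //; last exact: Ck_on_linear sndc idk.
  apply: (@Ck_on_comp _ _ _ _ _ T1 S1 fst
    (chart_to e \o h \o chart_from c)) => //.
  - exact: findim_rV.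
  - exact: Ck_on_linear fstc idk.
  - exact: (hs c e ac (chart_at_atlas _) j).
exists (T1 `&` g @^-1` S2).
  rewrite /T1 /S1 /g /=; split.
    by exists x => //; split=> //; exact: chart_at_dom.
  rewrite chart_toK //; exists (h x, y) => //=; split=> //.
  exact: chart_at_dom.
have oT : open (T1 `&` g @^-1` S2) by apply: open_setI_preimage => //; exact: gs 0%N.
apply: (Ck_on_eq oT _ (Ck_on_comp (findim_prod (findim_rV _) (findim_rV _))
   oT oS2 _ (Ck_onS _ (gs r)) (fs e d k (chart_at_atlas _) ad ak r))).
- move=> u [[x' [cx' ex'] ux'] _]; rewrite /g /= -ux' (chart_toK cx').
  by rewrite chart_toK.
- by move=> u [].
- by move=> u [].
Qed.

Lemma relaxed_augmented_lie_rack_triple (R : realType) (n p : nat)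
    (G : lieGroupType R n) (X : manifoldType R p) (act : G -> X -> X) (e : X)
    (Theta : X -> G) (G' : lie_subgroup G) :
  relaxed_augmented_lie_rack act e Theta G' ->
  lie_group_rack_triple act (rack_of_action act Theta) e Theta.
Proof.
move=> [actS fix_e Ts Tsub Te Teq]; split=> //; last first.
  by move=> x y; apply: Teq; exact: Tsub.
have [act_s act1 actM] := actS; rewrite /rack_of_action; split.
- by move=> x y z; rewrite Teq // -!actM mulgVK.
- move=> x; exists (act (Theta x)^-1%g) => y.
    by rewrite -actM mulVg act1.
  by rewrite -actM mulgV act1.
- by move=> x; rewrite Te act1.
- by move=> x; rewrite fix_e.
- exact: smooth2_compl.
Qed.

(* Main.v *)
Require Import Defs.
From HB Require Import structures.
From mathcomp Require Import all_boot all_order all_algebra.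
From mathcomp Require Import all_classical all_reals all_analysis.

Set Implicit Arguments.
Unset Strict Implicit.
Unset Printing Implicit Defensive.

Import Order.TTheory GRing.Theory Num.Theory.
Import numFieldNormedType.Exports.

Local Open Scope classical_set_scope.
Local Open Scope ring_scope.

(** At a fixed point [e] of a smooth action of [G], the tangent maps [T_e L_g]
    form a representation [T] of [G] on [V = T_e X], and the action of the Lie
    algebra on [V] is its differential at the unit. All the algebraic
    identities come from differentiating identities between smooth maps twice,
    in the chart at the unit, where the bracket of [a] and [b] is
    [B a b - B b a] for the mixed second derivative [B] of the
    multiplication.

    - Differentiating [T (g h) = T g \o T h] in [h], then in [g], expresses
      [a . (b . v)] as the sum of a second derivative of [T], symmetric in [a]
      and [b], and of the action of [B a b]; antisymmetrizing gives the module
      identity ([tangent_action_br]). The symmetry of second derivatives is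
      [schwarz].
    - Conjugation is an action of [G] on itself that fixes the unit, and its
      differential is the bracket ([adjoint_bracket]): differentiate
      [g h = (g h g^-1) g]. The Jacobi identity is then the module identity
      for the conjugation.
    - A smooth map between two such actions that is equivariant along a
      parameter manifold has an equivariant differential
      ([tangent_action_equivariant]). Applied to [Theta], with the subgroup as
      parameters and the conjugation on the target, this is the equivariance
      of [theta]; applied to a group morphism and the conjugations, it is the
      compatibility with brackets; applied to [Psi], it is the last condition
      on a morphism of Lie-Leibniz triples.

    The inclusion of the image of [theta] in the Lie algebra of the subgroup
    ([subgroup_tangent]) is of another nature, because the subgroup [G'] may
    fail to be closed. If [theta v] were outside, multiplying [G'] by the values
    of [Theta] along a curve of velocity [v] would give an immersion near the
    unit, which is injective nearby ([immersion_near_injective]); since these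
    values belong to [G'], this produces uncountably many disjoint open subsets
    of [G'], which is second countable. *)

(** * Germs of smooth maps between normed spaces *)

(** A single neighbourhood serves all orders of differentiability, so that
    directional derivatives of such a map are again of this kind. *)
Definition smooth_near (R : realType) (E F : normedModType R) (f : E -> F)
  (x : E) : Prop := exists2 A : set E, open_nbhs x A & smooth_on A f.

Section SmoothNear.
Context {R : realType}.
Implicit Types E F H : normedModType R.

Lemma smooth_near_eq E F (f g : E -> F) (x : E) :
  (\forall y \near x, f y = g y) -> smooth_near f x -> smooth_near g x.
Proof.
move=> fg [A [oA Ax] fA].
exists (A `&` [set y | f y = g y]°).
  split; last by split.
  by apply: openI => //; exact: open_interior.
move=> k; apply: (@Ck_on_eq _ _ _ _ _ f).
- by apply: openI => //; exact: open_interior.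
- by move=> y [_ /interior_subset].
- by apply: Ck_onS (fA k) => y [].
Qed.

Lemma smooth_near_nbhs E F (f : E -> F) (x : E) :
  smooth_near f x -> \forall y \near x, smooth_near f y.
Proof.
move=> [A oA fA]; apply: filterS (open_nbhs_nbhs oA) => y Ay.
by exists A => //; case: oA.
Qed.

Lemma smooth_near_differentiable E F (f : E -> F) (x : E) :
  smooth_near f x -> differentiable f x.
Proof. by move=> [A [_ Ax] fA]; have [/(_ x Ax)] := fA 1%N. Qed.

Lemma smooth_near_is_diff E F (f : E -> F) (x : E) :
  smooth_near f x -> is_diff x f ('d f x).
Proof. by move=> /smooth_near_differentiable /differentiableP. Qed.

Lemma smooth_near_continuous E F (f : E -> F) (x : E) :
  smooth_near f x -> {for x, continuous f}.
Proof.
by move=> /smooth_near_differentiable; exact: differentiable_continuous.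
Qed.

Lemma smooth_near_diff E F (f : E -> F) (x v : E) :
  smooth_near f x -> smooth_near (fun y => 'd f y v) x.
Proof.
by move=> [A oA fA]; exists A => // k; have [_ /(_ v)] := fA k.+1.
Qed.

Lemma smooth_near_cst E F (c : F) (x : E) : smooth_near (fun=> c) x.
Proof.
exists setT; first by split=> //; exact: openT.
by move=> k; apply: Ck_on_cst; exact: openT.
Qed.

Lemma smooth_near_id E (x : E) : smooth_near id x.
Proof.
exists setT; first by split=> //; exact: openT.
by move=> k; apply: Ck_on_id; exact: openT.
Qed.

Lemma smooth_near_linear E F H (L : {linear F -> H}) (f : E -> F) (x : E) :
  continuous L -> smooth_near f x -> smooth_near (fun y => L (f y)) x.
Proof.
move=> Lc [A [oA Ax] fA]; exists A => // k; exact: Ck_on_linear.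
Qed.

Lemma smooth_nearD E F (f g : E -> F) (x : E) :
  smooth_near f x -> smooth_near g x -> smooth_near (fun y => f y + g y) x.
Proof.
move=> [A [oA Ax] fA] [B [oB Bx] gB].
have oAB := openI oA oB; exists (A `&` B) => // k.
by apply: Ck_onD => //; [apply: Ck_onS (fA k) | apply: Ck_onS (gB k)] => ? [].
Qed.

Lemma smooth_near_pair E F H (f : E -> F) (g : E -> H) (x : E) :
  smooth_near f x -> smooth_near g x -> smooth_near (fun y => (f y, g y)) x.
Proof.
move=> [A [oA Ax] fA] [B [oB Bx] gB].
have oAB := openI oA oB; exists (A `&` B) => // k.
apply: Ck_on_pair => //.
  by apply: Ck_onS (fA k) => ? [].
by apply: Ck_onS (gB k) => ? [].
Qed.

Lemma smooth_near_comp E F H (f : E -> F) (g : F -> H) (x : E) (y : F) :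
  findim F -> f x = y -> smooth_near f x -> smooth_near g y ->
  smooth_near (fun z => g (f z)) x.
Proof.
move=> fdF <- fx [B [oB Bfx] gB]; have := fx; move=> [A [oA Ax] fA].
have oAB : open (A `&` f @^-1` B).
  by apply: open_setI_preimage => // z Az; exact: (fA 0%N).
exists (A `&` f @^-1` B) => // k.
apply: (Ck_on_comp fdF oAB oB _ _ (gB k)) => [z []//|].
by apply: Ck_onS (fA k) => ? [].
Qed.

Lemma smooth_near_fst E F (x : E * F) : smooth_near fst x.
Proof.
apply: (@smooth_near_linear _ _ _ (@fst E F) id); last exact: smooth_near_id.
by move=> z; exact: cvg_fst.
Qed.

Lemma near_diff E F (f g : E -> F) (x : E) :
  (\forall y \near x, f y = g y) -> differentiable f x ->
  'd g x = 'd f x :> (E -> F).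
Proof. by move=> fg /differentiableP fd; have [_ ->] := near_is_diff fg fd. Qed.

Lemma near_diff_id E (f : E -> E) x v :
  (\forall u \near x, f u = u) -> 'd f x v = v.
Proof.
move=> fE; have H : \forall u \near x, id u = f u by apply: filterS fE => u ->.
by have [_ ->] := near_is_diff H (is_diff_id x).
Qed.

(** The point of differentiation of [g] is free: rewriting it inside ['d] is
    prevented by the dependent types there. *)
Lemma is_diff_comp_at E F H (f df : E -> F) (g dg : F -> H) x y :
  is_diff x f df -> f x = y -> is_diff y g dg -> is_diff x (g \o f) (dg \o df).
Proof. by move=> fd <- gd; exact: is_diff_comp. Qed.

Lemma is_diff_pair1 E F (x : E) (y : F) :
  is_diff x (fun x => (x, y)) (fun a => (a, 0)).
Proof. exact: is_diff_pair. Qed.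

Lemma is_diff_pair2 E F (x : E) (y : F) :
  is_diff y (fun y => (x, y)) (fun b => (0, b)).
Proof. exact: is_diff_pair. Qed.

Lemma diff_partial1 E F H (f : E * F -> H) (x : E) (y : F) a :
  differentiable f (x, y) ->
  'd (fun x => f (x, y)) x a = 'd f (x, y) (a, 0).
Proof.
move=> fd; have xd := is_diff_pair1 x y.
by have [_ ->] := is_diff_comp xd (differentiableP fd).
Qed.

Lemma diff_partial2 E F H (f : E * F -> H) (x : E) (y : F) b :
  differentiable f (x, y) ->
  'd (fun y => f (x, y)) y b = 'd f (x, y) (0, b).
Proof.
move=> fd; have yd := is_diff_pair2 x y.
by have [_ ->] := is_diff_comp yd (differentiableP fd).
Qed.

Lemma near_prod_curry E F (P : E * F -> Prop) (x : E) (y : F) :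
  (\forall z \near (x, y), P z) ->
  \forall a \near x, \forall b \near y, P (a, b).
Proof.
move=> [[A B] /= [Ax By] AB]; apply: filterS Ax => a Aa.
by apply: filterS By => b Bb; exact: AB.
Qed.

Lemma is_diff_sum E F n (f df : 'I_n -> E -> F) (x : E) :
  (forall i, is_diff x (f i) (df i)) ->
  is_diff x (fun y => \sum_i f i y) (fun a => \sum_i df i a).
Proof.
elim: n f df => [|n IH] f df fd.
  rewrite (_ : (fun y => _) = cst 0); last first.
    by apply/funext=> y; rewrite big_ord0.
  rewrite (_ : (fun a => _) = 0); last by apply/funext=> y; rewrite big_ord0.
  exact: is_diff_cst.
have := is_diffD (fd ord0) (IH _ _ (fun i => fd (lift ord0 i))).
by congr is_diff_def; apply/funext => y /=; rewrite big_ord_recl.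
Qed.

Lemma coord_linear m (j : 'I_m) : exists2 l : {linear 'rV[R]_m -> R^o},
  continuous l & forall w, l w = w 0 j.
Proof.
have [i c u v|l lE] :=
    @linear_choice R 'rV[R]_m R^o m (fun j w => w 0 j).
  by rewrite !mxE.
exists (l j); first by rewrite lE; exact: coord_continuous.
by move=> w; rewrite lE.
Qed.

Lemma is_diff_coord E m (f df : E -> 'rV[R]_m) (x : E) (j : 'I_m) :
  is_diff x f df -> is_diff x (fun y => f y 0 j : R^o) (fun a => df a 0 j).
Proof.
move=> fd; have [l lc lE] := coord_linear j.
have ld : is_diff (f x) l l.
  by split; [exact: linear_differentiable | exact: diff_lin].
by have := is_diff_comp fd ld; congr is_diff_def; apply/funext => y; exact: lE.
Qed.

Lemma smooth_near_coord E m (f : E -> 'rV[R]_m) (x : E) (j : 'I_m) :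
  smooth_near f x -> smooth_near (fun y => f y 0 j : R^o) x.
Proof.
have [l lc lE] := coord_linear j.
move=> /(smooth_near_linear lc).
by rewrite (_ : (fun y => l (f y)) = fun y => f y 0 j) //; apply/funext => y.
Qed.

(** The product rule for evaluation. Expanding [g] in the standard basis
    reduces it to finitely many products of a scalar and a vector. *)
Lemma is_diff_family E F m (T : E -> {linear 'rV[R]_m -> F}) (g : E -> 'rV[R]_m)
    (x : E) :
  (forall v, differentiable (fun y => T y v) x) -> differentiable g x ->
  is_diff x (fun y => T y (g y))
    (fun a => 'd (fun y => T y (g x)) x a + T x ('d g x a)).
Proof.
move=> Td gd.
have TE y v : T y v = \sum_j v 0 j *: T y (delta_mx 0 j).
  rewrite {1}(row_sum_delta v) linear_sum; apply: eq_bigr => j _.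
  exact: linearZ.
have dT v : 'd (fun y => T y v) x = (fun a =>
    \sum_j v 0 j *: 'd (fun y => T y (delta_mx 0 j)) x a) :> (E -> F).
  have dj j : is_diff x (fun y => v 0 j *: T y (delta_mx 0 j))
      (fun a => v 0 j *: 'd (fun y => T y (delta_mx 0 j)) x a).
    by have := is_diffZ (v 0 j) (differentiableP (Td (delta_mx 0 j))).
  have [_ <-] := is_diff_sum dj; congr ('d _ _ : E -> F).
  by apply/funext => y; rewrite [LHS]TE.
have dj j : is_diff x (fun y => (g y) 0 j *: T y (delta_mx 0 j))
    (fun a => g x 0 j *: 'd (fun y => T y (delta_mx 0 j)) x a +
              ('d g x a) 0 j *: T x (delta_mx 0 j)).
  apply: (is_diffZf (a := fun y => g y 0 j) (da := fun a => 'd g x a 0 j)).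
    exact: (is_diff_coord j (differentiableP gd)).
  exact: differentiableP (Td (delta_mx 0 j)).
have := is_diff_sum dj.
congr is_diff_def; apply/funext => a; first by rewrite [RHS]TE.
by rewrite big_split /= dT (TE x ('d g x a)).
Qed.

Lemma linear_rV_continuous m F (L : {linear 'rV[R]_m -> F}) : continuous L.
Proof.
move=> x; apply: differentiable_continuous.
have [] // := @is_diff_family 'rV[R]_m F m (fun=> L) id x.
Qed.

Lemma linear_rV_is_diff m F (L : {linear 'rV[R]_m -> F}) x : is_diff x L L.
Proof.
have Lc := @linear_rV_continuous m F L.
by split; [exact: linear_differentiable | exact: diff_lin].
Qed.

(** * Symmetry of second derivatives *)

Lemma is_derive_line E F (f : E -> F) (z v : E) (t : R) :
  differentiable f (z + t *: v) ->
  is_derive t (1 : R) (fun s : R => f (z + s *: v)) ('d f (z + t *: v) v).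
Proof.
move=> fd.
have ld : is_diff (t : R^o) (fun s : R^o => z + s *: v) (fun s : R^o => s *: v).
  have := is_diffD (is_diff_cst z (t : R^o)) (is_diff_scalel t v).
  by congr is_diff_def; apply/funext => s /=; rewrite [LHS]add0r.
have [gd gE] := is_diff_comp ld (differentiableP fd).
apply: DeriveDef; first exact: diff_derivable.
by rewrite deriveE // gE /= scale1r.
Qed.

Lemma MVT_closed (f df : R -> R) (a b : R) : a < b ->
  (forall x, a <= x <= b -> is_derive x 1 f (df x)) ->
  exists2 c, a < c < b & f b - f a = df c * (b - a).
Proof.
move=> ab fd; have [||c] := @MVT R f df a b ab.
- by move=> x; rewrite in_itv /= => /andP[ax xb]; apply: fd; rewrite !ltW.
- apply: derivable_within_continuous => x; rewrite in_itv /= => /fd xd.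
  exact: ex_derive.
by rewrite in_itv /= => ? ?; exists c.
Qed.

(** The mean value theorem in direction [v], then in direction [w]. Since the
    left side is symmetric in [v] and [w], so is the limit of the second
    derivative on the right as [h] tends to 0. *)
Lemma second_difference E (f : E -> R^o) (x v w : E) (P : set E) :
  nbhs x P -> (forall y, P y -> differentiable f y) ->
  (forall y, P y -> differentiable (fun z => 'd f z v : R^o) y) ->
  exists2 d : R, 0 < d & forall h, 0 < h < d -> exists2 z, P z &
    f (x + h *: v + h *: w) - f (x + h *: v) - f (x + h *: w) + f x =
    'd (fun y => 'd f y v : R^o) z w * h * h.
Proof.
move=> xP fd fdd.
pose p (s : R^o * R^o) := x + s.1 *: v + s.2 *: w.
have pc : {for (0, 0), continuous p}.
  apply: (@continuousD); last first.
    by apply: cvgZr_tmp; exact: cvg_snd.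
  apply: continuousD; first exact: cvg_cst.
  by apply: cvgZr_tmp; exact: cvg_fst.
have : nbhs ((0, 0) : R^o * R^o) (p @^-1` P).
  by apply: pc; rewrite /p /= !scale0r !addr0.
move=> /nbhs_ballP[d /= d0 dP]; exists d => // h /andP[h0 hd].
have Ps s t : 0 <= s <= h -> 0 <= t <= h -> P (x + s *: v + t *: w).
  move=> /andP[s0 sh] /andP[t0 th]; apply: (dP (s, t)); split=> /=.
    by rewrite /ball /= sub0r normrN ger0_norm // (le_lt_trans sh).
  by rewrite /ball /= sub0r normrN ger0_norm // (le_lt_trans th).
have h00 : 0 <= (0 : R) <= h by rewrite lexx ltW.
have hh : 0 <= h <= h by rewrite lexx ltW.
have P1 s : 0 <= s <= h -> is_derive s (1 : R)
   (fun s => f ((x + h *: w) + s *: v) - f (x + s *: v))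
   ('d f ((x + h *: w) + s *: v) v - 'd f (x + s *: v) v).
  move=> sh; apply: is_deriveB; apply: is_derive_line; apply: fd.
    by rewrite addrAC; exact: Ps.
  by have := Ps s 0 sh h00; rewrite scale0r addr0.
have [xi /andP[xi0 xih]] := MVT_closed h0 P1.
have xiP : 0 <= xi <= h by rewrite !ltW.
have P2 t : 0 <= t <= h -> is_derive t (1 : R)
   (fun t => 'd f ((x + xi *: v) + t *: w) v : R)
   ('d (fun y => 'd f y v : R^o) ((x + xi *: v) + t *: w) w).
  by move=> th; apply: is_derive_line; apply: fdd; exact: Ps.
have [eta /andP[eta0 etah]] := MVT_closed h0 P2.
have etaP : 0 <= eta <= h by rewrite !ltW.
rewrite !subr0 !scale0r !addr0 => E2 E1.
exists (x + xi *: v + eta *: w); first exact: Ps.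
rewrite -E2 (addrAC x (xi *: v)) -E1 (addrAC x (h *: w)) opprB.
by rewrite -[LHS]addrA [X in _ + X = _]addrC.
Qed.

Lemma schwarz_real E (f : E -> R^o) (x v w : E) : smooth_near f x ->
  'd (fun y => 'd f y v : R^o) x w = 'd (fun y => 'd f y w : R^o) x v.
Proof.
move=> fx; have fxn := smooth_near_nbhs fx.
set a := LHS; set b := RHS.
have sndc v' w' :
    {for x, continuous (fun z => 'd (fun y => 'd f y v' : R^o) z w' : R^o)}.
  exact/smooth_near_continuous/smooth_near_diff/smooth_near_diff.
apply/eqP; rewrite -subr_eq0 -normr_le0; apply/ler_addgt0Pr => e e0.
rewrite add0r.
have e20 : 0 < e / 2 by rewrite divr_gt0.
pose P1 := [set y | smooth_near f y /\
  `|a - 'd (fun y => 'd f y v : R^o) y w| < e / 2].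
pose P2 := [set y | smooth_near f y /\
  `|b - 'd (fun y => 'd f y w : R^o) y v| < e / 2].
have nP1 : nbhs x P1.
  apply: filterI => //; have := sndc v w.
  by move=> /cvgrPdist_lt /(_ _ e20).
have nP2 : nbhs x P2.
  apply: filterI => //; have := sndc w v.
  by move=> /cvgrPdist_lt /(_ _ e20).
have sd y v' : smooth_near f y -> differentiable (fun z => 'd f z v' : R^o) y.
  by move=> fy; apply: smooth_near_differentiable; exact: smooth_near_diff.
have [||d1 d10 D1] := @second_difference _ f x v w _ nP1.
- by move=> y [/smooth_near_differentiable].
- by move=> y [fy _]; exact: sd.
have [||d2 d20 D2] := @second_difference _ f x w v _ nP2.
- by move=> y [/smooth_near_differentiable].
- by move=> y [fy _]; exact: sd.
pose h := Num.min d1 d2 / 2.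
have m0 : 0 < Num.min d1 d2 by rewrite lt_min d10.
have h0 : 0 < h by rewrite divr_gt0.
have hm : h < Num.min d1 d2 by rewrite ltr_pdivrMr // ltr_pMr // ltr1n.
have [|z1 [_ z1a] E1] := D1 h.
  by rewrite h0 (lt_le_trans hm) // ge_min lexx.
have [|z2 [_ z2b] E2] := D2 h.
  by rewrite h0 (lt_le_trans hm) // ge_min lexx orbT.
have E12 : 'd (fun y => 'd f y v : R^o) z1 w =
    'd (fun y => 'd f y w : R^o) z2 v.
  apply: (mulIf (lt0r_neq0 h0)); apply: (mulIf (lt0r_neq0 h0)).
  by rewrite -E1 -E2 (addrAC x) (addrAC (f _) (- f (x + h *: v))).
rewrite ltW // (splitr e) -(subrKA ('d (fun y => 'd f y v : R^o) z1 w)).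
rewrite (le_lt_trans (ler_normD _ _)) // ltrD //.
by rewrite E12 distrC.
Qed.

Lemma schwarz E m (f : E -> 'rV[R]_m) (x v w : E) : smooth_near f x ->
  'd (fun y => 'd f y v) x w = 'd (fun y => 'd f y w) x v.
Proof.
move=> fx; apply/rowP => j.
have key v' w' : 'd (fun y => 'd f y v') x w' 0 j =
    'd (fun y => 'd (fun z => f z 0 j : R^o) y v' : R^o) x w'.
  have d1 := smooth_near_differentiable (smooth_near_diff v' fx).
  have [d2 d2E] := is_diff_coord j (differentiableP d1).
  transitivity ('d (fun y => 'd f y v' 0 j : R^o) x w'); first by rewrite d2E.
  apply: (f_equal (fun g => g w')); apply/esym; apply: near_diff => //.
  apply: filterS (smooth_near_nbhs fx) => y /smooth_near_differentiable fy.
  by have [_ ->] := is_diff_coord j (differentiableP fy).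
rewrite !key; apply: schwarz_real; exact: smooth_near_coord.
Qed.

Lemma near_diff_partial2 E F H (f : E * F -> H) x y :
  smooth_near f (x, y) ->
  \forall u \near x, forall b, 'd (fun w => f (u, w)) y b = 'd f (u, y) (0, b).
Proof.
move=> /smooth_near_nbhs /near_prod_curry; apply: filterS => u fu b.
exact/diff_partial2/smooth_near_differentiable/(nbhs_singleton fu).
Qed.

Lemma near_diff_partial1 E F H (f : E * F -> H) x y :
  smooth_near f (x, y) ->
  \forall w \near y, forall a, 'd (fun u => f (u, w)) x a = 'd f (x, w) (a, 0).
Proof.
move=> /smooth_near_nbhs fs.
have pc : {for y, continuous (fun w : F => (x, w))}.
  by apply: cvg_pair; [exact: cvg_cst | exact: cvg_id].
have n : \forall w \near y, smooth_near f (x, w) := pc _ fs.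
apply: filterS n => w fw a.
exact/diff_partial1/smooth_near_differentiable.
Qed.

Lemma smooth_near_partial2 E F H (f : E * F -> H) x y b :
  findim E -> findim F -> smooth_near f (x, y) ->
  smooth_near (fun u => 'd (fun w => f (u, w)) y b) x.
Proof.
move=> fE fF fs; apply: (@smooth_near_eq _ _ (fun u => 'd f (u, y) (0, b))).
  by apply: filterS (near_diff_partial2 fs) => u ->.
apply: (@smooth_near_comp _ _ _ (fun u => (u, y)) (fun z => 'd f z (0, b)) _ _
  (findim_prod fE fF) erefl); last exact: smooth_near_diff.
by apply: smooth_near_pair; [exact: smooth_near_id | exact: smooth_near_cst].
Qed.

Lemma smooth_near_partial1 E F H (f : E * F -> H) x y a :
  findim E -> findim F -> smooth_near f (x, y) ->
  smooth_near (fun w => 'd (fun u => f (u, w)) x a) y.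
Proof.
move=> fE fF fs; apply: (@smooth_near_eq _ _ (fun w => 'd f (x, w) (a, 0))).
  by apply: filterS (near_diff_partial1 fs) => w ->.
apply: (@smooth_near_comp _ _ _ (fun w => (x, w)) (fun z => 'd f z (a, 0)) _ _
  (findim_prod fE fF) erefl); last exact: smooth_near_diff.
by apply: smooth_near_pair; [exact: smooth_near_cst | exact: smooth_near_id].
Qed.

Lemma schwarz_partial E F m (f : E * F -> 'rV[R]_m) x y a b :
  smooth_near f (x, y) ->
  'd (fun u => 'd (fun w => f (u, w)) y b) x a =
  'd (fun w => 'd (fun u => f (u, w)) x a) y b.
Proof.
move=> fs.
have d2 : differentiable (fun z => 'd f z (0, b)) (x, y).
  exact/smooth_near_differentiable/smooth_near_diff.
have d1 : differentiable (fun z => 'd f z (a, 0)) (x, y).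
  exact/smooth_near_differentiable/smooth_near_diff.
have d2x : differentiable (fun u => 'd f (u, y) (0, b)) x.
  by have [] := is_diff_comp (is_diff_pair1 x y) (differentiableP d2).
have d1y : differentiable (fun w => 'd f (x, w) (a, 0)) y.
  by have [] := is_diff_comp (is_diff_pair2 x y) (differentiableP d1).
have e2 : \forall u \near x, 'd f (u, y) (0, b) = 'd (fun w => f (u, w)) y b.
  by apply: filterS (near_diff_partial2 fs) => u ->.
have e1 : \forall w \near y, 'd f (x, w) (a, 0) = 'd (fun u => f (u, w)) x a.
  by apply: filterS (near_diff_partial1 fs) => w ->.
have E2 := f_equal (fun h => h a) (near_diff e2 d2x).
have E1 := f_equal (fun h => h b) (near_diff e1 d1y).
have E2' := diff_partial1 a d2.
have E1' := diff_partial2 b d1.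
have S := @schwarz (E * F)%type m f (x, y) (0, b) (a, 0) fs.
exact: etrans (etrans E2 E2') (etrans S (esym (etrans E1 E1'))).
Qed.

End SmoothNear.

(** * Immersions are locally injective *)

Section Injective.
Context {R : realType}.
Implicit Types E F H : normedModType R.

Lemma le_mx_norm m (x : 'rV[R]_m) j : `|x 0 j| <= `|x|.
Proof. by rewrite [leRHS]mx_normrE; apply: (le_bigmax _ _ (0, j)). Qed.

Lemma linear_rV_bound m n (L : {linear 'rV[R]_m -> 'rV[R]_n}) (c : R) v j :
  (forall i, `|L (delta_mx 0 i) 0 j| <= c) -> `|L v 0 j| <= `|v| * c *+ m.
Proof.
move=> Lc; rewrite {1}(row_sum_delta v) linear_sum summxE.
apply: (le_trans (ler_norm_sum _ _ _)).
have -> : `|v| * c *+ m = \sum_(i < m) `|v| * c by rewrite sumr_const card_ord.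
apply: ler_sum => i _.
by rewrite linearZ mxE normrM ler_pM // le_mx_norm.
Qed.

Lemma row_le_half m (v : 'rV[R]_m) : (forall j, `|v 0 j| <= `|v| / 2) -> v = 0.
Proof.
move=> vj; apply/eqP; rewrite -normr_eq0; apply/negPn/negP => v0.
have [[i j] /= vE] := mx_norm_neq0 v0.
have := vj j; rewrite -(ord1 i) -vE -[mx_norm v]/`|v| leNgt ltr_pdivrMr //.
by rewrite ltr_pMr ?ltr1n // lt0r v0 normr_ge0.
Qed.

Lemma ball_segment E (x y z : E) (e s : R) : ball x e y -> ball x e z ->
  0 <= s <= 1 -> ball x e (y + s *: (z - y)).
Proof.
rewrite -!ball_normE /= => xy xz /andP[s0 s1].
have -> : x - (y + s *: (z - y)) = (1 - s) *: (x - y) + s *: (x - z).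
  rewrite scalerBl scale1r -addrA -scalerN -scalerDr opprB.
  by rewrite addrA subrK opprD addrA -scalerN opprB.
have s1' : 0 <= 1 - s by rewrite subr_ge0.
rewrite (le_lt_trans (ler_normD _ _)) // !normrZ !ger0_norm //.
have [->|sn1] := eqVneq s 1; first by rewrite subrr mul0r add0r mul1r.
have -> : e = (1 - s) * e + s * e by rewrite -mulrDl subrK mul1r.
rewrite ltr_leD //.
  by rewrite ltr_pM2l // subr_gt0 lt_neqAle sn1.
by rewrite ler_wpM2l // ltW.
Qed.

(** The entries of the Jacobian vanish at [x], so they are at most
    [1 / (2 (m + 1))] nearby, and the mean value theorem applies to each
    coordinate of [g] along a segment. *)
Lemma contraction_near m (g : 'rV[R]_m -> 'rV[R]_m) x :
  smooth_near g x -> (forall v, 'd g x v = 0) ->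
  exists2 d : R, 0 < d & forall y z, ball x d y -> ball x d z ->
    forall j, `|g z 0 j - g y 0 j| <= `|z - y| / 2.
Proof.
move=> gx dg0; pose c : R := (2 * m.+1%:R)^-1.
have c0 : 0 < c by rewrite invr_gt0 mulr_gt0 // ltr0n.
have near_c : \forall y \near x, forall i j, `|'d g y (delta_mx 0 i) 0 j| <= c.
  pose P i j := fun y => `|'d g y (delta_mx 0 i) 0 j| <= c.
  have F := nbhs_filter x.
  apply: (@filter_forall _ _ (fun i y => forall j, P i j y) _ F) => i.
  apply: (@filter_forall _ _ (P i) _ F) => j.
  have dc := smooth_near_continuous
    (smooth_near_coord j (smooth_near_diff (delta_mx 0 i) gx)).
  pose h (y : 'rV[R]_m) : R := 'd g y (delta_mx 0 i) 0 j.
  have hc : h @ x --> h x := dc.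
  have hx : h x = 0 by rewrite /h dg0 mxE.
  move/cvgrPdist_lt : hc => /(_ _ c0); rewrite hx.
  by apply: filterS => y; rewrite sub0r normrN => /ltW.
have /nbhs_ballP[d /= d0 dP] : nbhs x [set y |
    (forall i j, `|'d g y (delta_mx 0 i) 0 j| <= c) /\ smooth_near g y].
  exact: filterI near_c (smooth_near_nbhs gx).
exists d => // y z xy xz j.
have D (s : R) : 0 <= s <= 1 -> is_derive s (1 : R)
    (fun s : R => g (y + s *: (z - y)) 0 j : R)
    ('d g (y + s *: (z - y)) (z - y) 0 j).
  move=> s01; have [_ gs] := dP _ (ball_segment xy xz s01).
  have [gd gE] := is_diff_coord j (smooth_near_is_diff gs).
  by have := is_derive_line gd; rewrite gE.
have [s /andP[s0 s1]] := MVT_closed (@ltr01 R) D.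
rewrite scale1r scale0r addr0 subr0 mulr1 [y + _]addrC subrK => ->.
have s01 : 0 <= s <= 1 by rewrite !ltW.
have [/(_ _ j) cj _] := dP _ (ball_segment xy xz s01).
apply: (le_trans (linear_rV_bound _ cj)).
rewrite -mulrnAr ler_wpM2l // -[c *+ m]mulr_natl /c invfM mulrCA.
by rewrite ler_piMr ?invr_ge0 // ler_pdivrMr ?ltr0n // mul1r ler_nat.
Qed.

(** If the matrix [B] inverts the differential of [f] at [x] on the left, then
    [y |-> f y *m B - y] has zero differential at [x], hence contracts
    distances near [x]; if [f y = f z], it maps [y], [z] to points at the
    distance [`|y - z|]. *)
Lemma immersion_near_injective m n (f : 'rV[R]_m -> 'rV[R]_n) x :
  smooth_near f x -> (forall v, 'd f x v = 0 -> v = 0) ->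
  exists2 d : R, 0 < d & forall y z, ball x d y -> ball x d z ->
    f y = f z -> y = z.
Proof.
move=> fx dfx.
have /row_freeP[B BE] : row_free (lin1_mx ('d f x)).
  by apply: inj_row_free => v; rewrite mul_rV_lin1; exact: dfx.
pose L := mulmxr B : {linear 'rV[R]_n -> 'rV[R]_m}.
have LE v : L ('d f x v) = v.
  by rewrite /L /= -mul_rV_lin1 -mulmxA BE mulmx1.
pose g y := L (f y) - y.
have gx : smooth_near g x.
  apply: smooth_nearD.
    exact: smooth_near_linear (@linear_rV_continuous _ _ _ L) fx.
  apply: (@smooth_near_linear _ _ _ _ (@GRing.opp 'rV[R]_m) id).
    exact: opp_continuous.
  exact: smooth_near_id.
have dg0 v : 'd g x v = 0.
  have fd := smooth_near_is_diff fx.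
  have Ld := linear_rV_is_diff L (f x).
  have [_ gE] := is_diffB (is_diff_comp fd Ld) (is_diff_id x).
  by rewrite [LHS](f_equal (fun h => h v) gE) /= !fctE LE subrr.
have [d d0 dP] := contraction_near gx dg0; exists d => // y z xy xz fyz.
apply/eqP; rewrite -subr_eq0; apply/eqP/row_le_half => j.
by have := dP y z xy xz j; rewrite /g fyz !mxE opprD addrACA subrr add0r opprK
  addrC distrC [`|z - y|]distrC distrC.
Qed.

End Injective.

(** * Smooth maps between manifolds in charts *)

Definition chart_map (R : realType) m n (M N : topologicalType)
  (c : chart R m M) (d : chart R n N) (f : M -> N) : 'rV[R]_m -> 'rV[R]_n :=
  chart_to d \o f \o chart_from c.

Definition chart_map2 (R : realType) m n p (M N P : topologicalType)
  (c : chart R m M) (d : chart R n N) (k : chart R p P) (f : M -> N -> P) :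
  'rV[R]_m * 'rV[R]_n -> 'rV[R]_p :=
  fun u => chart_to k (f (chart_from c u.1) (chart_from d u.2)).

Section Charts.
Context {R : realType}.

Lemma chart_from_cvg n (M : topologicalType) (c : chart R n M) x :
  chart_dom c x -> chart_from c @ chart_to c x --> x.
Proof.
move=> cx; have u : (chart_to c @` chart_dom c) (chart_to c x) by exists x.
by have := chart_from_continuous u; rewrite /prop_for /continuous_at chart_toK.
Qed.

Lemma near_chart_from n (M : topologicalType) (c : chart R n M) x (P : set M) :
  chart_dom c x -> (\forall y \near x, P y) ->
  \forall u \near chart_to c x, P (chart_from c u).
Proof. by move=> /chart_from_cvg; apply. Qed.

Lemma near_chart_from2 m n (M N : topologicalType) (c : chart R m M)
    (d : chart R n N) x y (P : set (M * N)) :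
  chart_dom c x -> chart_dom d y -> (\forall z \near (x, y), P z) ->
  \forall u \near (chart_to c x, chart_to d y),
    P (chart_from c u.1, chart_from d u.2).
Proof.
move=> cx dy [[A B] /= [Ax By] AB].
exists (chart_from c @^-1` A, chart_from d @^-1` B) => /=.
  by split; [exact: chart_from_cvg cx _ Ax | exact: chart_from_cvg dy _ By].
by move=> [u v] /= [Au Bv]; exact: AB.
Qed.

Lemma near_chart_dom n (M : topologicalType) (c : chart R n M) x :
  chart_dom c x -> \forall y \near x, chart_dom c y.
Proof.
by move=> cx; apply: open_nbhs_nbhs; split => //; exact: chart_dom_open.
Qed.

Lemma near_chart_dom_comp n (T M : topologicalType) (c : chart R n M)
    (f : T -> M) x : {for x, continuous f} ->
  chart_dom c (f x) -> \forall y \near x, chart_dom c (f y).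
Proof. by move=> fc /near_chart_dom; exact: fc. Qed.

(** Smoothness concerns germs, so it can be checked around each point, in
    charts of one's choice. *)
Lemma smoothP m n (M : manifoldType R m) (N : manifoldType R n) (f : M -> N) :
  smooth f <-> continuous f /\
  forall x (c : chart R m M) (d : chart R n N), atlas c -> atlas d ->
    chart_dom c x -> chart_dom d (f x) ->
    smooth_near (chart_map c d f) (chart_to c x).
Proof.
split=> -[fc fs]; split=> //.
  move=> x c d ac ad cx dx.
  exists (chart_to c @` (chart_dom c `&` f @^-1` chart_dom d)); last exact: fs.
  split; last by exists x.
  apply: chart_image_open; apply: open_comp (chart_dom_open _).
  by move=> ? _; exact: fc.
move=> c d ac ad k; apply: Ck_on_pointwise => _ [x [cx dx] <-].
by have [A [_ Ax] fA] := fs x c d ac ad cx dx; exists A => //; exact: fA.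
Qed.

Lemma smooth2P m n p (M : manifoldType R m) (N : manifoldType R n)
    (P : manifoldType R p) (f : M -> N -> P) :
  smooth2 f <-> continuous (fun z : M * N => f z.1 z.2) /\
  forall x y (c : chart R m M) (d : chart R n N) (k : chart R p P),
    atlas c -> atlas d -> atlas k ->
    chart_dom c x -> chart_dom d y -> chart_dom k (f x y) ->
    smooth_near (chart_map2 c d k f) (chart_to c x, chart_to d y).
Proof.
split=> -[fc fs]; split=> //.
  move=> x y c d k ac ad ak cx dy kxy.
  exists ((fun z : M * N => (chart_to c z.1, chart_to d z.2)) @`
    [set z | [/\ chart_dom c z.1, chart_dom d z.2 & chart_dom k (f z.1 z.2)]]);
    last exact: fs.
  split; last by exists (x, y).
  have oO : open ((fun z : M * N => f z.1 z.2) @^-1` chart_dom k).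
    by apply: open_comp (chart_dom_open _) => ? _; exact: fc.
  exact: (@chart2_image_open _ _ _ _ _ c d _ oO).
move=> c d k ac ad ak r; apply: Ck_on_pointwise => _ [[x y] /= [cx dy kxy] <-].
have [A [_ Ax] fA] := fs x y c d k ac ad ak cx dy kxy.
by exists A => //; exact: fA.
Qed.

Lemma smooth_chart_map m n (M : manifoldType R m) (N : manifoldType R n)
    (f : M -> N) x (c : chart R m M) (d : chart R n N) :
  smooth f -> atlas c -> atlas d -> chart_dom c x -> chart_dom d (f x) ->
  smooth_near (chart_map c d f) (chart_to c x).
Proof. by move=> /smoothP[_ fs]; exact: fs. Qed.

Lemma smooth_cont m n (M : manifoldType R m) (N : manifoldType R n)
    (f : M -> N) : smooth f -> continuous f.
Proof. by case. Qed.

Lemma smooth_id n (M : manifoldType R n) : smooth (@id M).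
Proof.
split; first by move=> x; exact: cvg_id.
by move=> c d ac ad; exact: atlas_compatible.
Qed.

Lemma smooth2_slicer m n p (M : manifoldType R m) (N : manifoldType R n)
    (P : manifoldType R p) (f : M -> N -> P) x : smooth2 f -> smooth (f x).
Proof.
move=> /smooth2P[fc fs]; apply/smoothP; split.
  move=> y.
  apply: (@continuous_comp _ _ _ (fun y => (x, y)) (fun z => f z.1 z.2)).
    by apply: cvg_pair; [exact: cvg_cst | exact: cvg_id].
  exact: fc.
move=> y d k ad ak dy ky; pose c := chart_at x.
rewrite (_ : chart_map d k (f x) =
  chart_map2 c d k f \o (fun v => (chart_to c x, v))); last first.
  apply/funext => v; rewrite /chart_map /chart_map2 /= chart_toK //.
  exact: chart_at_dom.
apply: (smooth_near_comp (findim_prod (findim_rV _) (findim_rV _)) erefl).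
  by apply: smooth_near_pair; [exact: smooth_near_cst | exact: smooth_near_id].
by apply: fs => //; [exact: chart_at_atlas | exact: chart_at_dom].
Qed.

Lemma smooth2_slicel m n p (M : manifoldType R m) (N : manifoldType R n)
    (P : manifoldType R p) (f : M -> N -> P) y : smooth2 f -> smooth (f^~ y).
Proof.
move=> /smooth2P[fc fs]; apply/smoothP; split.
  move=> x.
  apply: (@continuous_comp _ _ _ (fun x => (x, y)) (fun z => f z.1 z.2)).
    by apply: cvg_pair; [exact: cvg_id | exact: cvg_cst].
  exact: fc.
move=> x c k ac ak cx kx; pose d := chart_at y.
rewrite (_ : chart_map c k (f^~ y) =
  chart_map2 c d k f \o (fun v => (v, chart_to d y))); last first.
  apply/funext => v; rewrite /chart_map /chart_map2 /= chart_toK //.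
  exact: chart_at_dom.
apply: (smooth_near_comp (findim_prod (findim_rV _) (findim_rV _)) erefl).
  by apply: smooth_near_pair; [exact: smooth_near_id | exact: smooth_near_cst].
by apply: fs => //; [exact: chart_at_atlas | exact: chart_at_dom].
Qed.

Lemma smooth2_comp m n p1 p2 q (M : manifoldType R m) (N : manifoldType R n)
    (P1 : manifoldType R p1) (P2 : manifoldType R p2) (Q : manifoldType R q)
    (f : M -> N -> P1) (g : M -> N -> P2) (h : P1 -> P2 -> Q) :
  smooth2 f -> smooth2 g -> smooth2 h -> smooth2 (fun x y => h (f x y) (g x y)).
Proof.
move=> /smooth2P[fc fs] /smooth2P[gc gs] /smooth2P[hc hs].
apply/smooth2P; split.
  move=> z; apply: (@continuous_comp _ _ _
    (fun z => (f z.1 z.2, g z.1 z.2)) (fun z => h z.1 z.2)); last exact: hc.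
  by apply: cvg_pair; [exact: fc | exact: gc].
move=> x y c d k ac ad ak cx dy kxy.
pose e1 := chart_at (f x y); pose e2 := chart_at (g x y).
have a1 : atlas e1 := chart_at_atlas _.
have a2 : atlas e2 := chart_at_atlas _.
have x1 : chart_dom e1 (f x y) := chart_at_dom _.
have x2 : chart_dom e2 (g x y) := chart_at_dom _.
apply: (@smooth_near_eq _ _ _ (chart_map2 e1 e2 k h \o
    (fun u => (chart_map2 c d e1 f u, chart_map2 c d e2 g u)))).
  have n1 := near_chart_from2 cx dy (near_chart_dom_comp (fc (x, y)) x1).
  have n2 := near_chart_from2 cx dy (near_chart_dom_comp (gc (x, y)) x2).
  by apply: filterS2 n1 n2 => u u1 u2; rewrite /chart_map2 /= !chart_toK.
apply: (smooth_near_comp (findim_prod (findim_rV _) (findim_rV _)) erefl).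
  by apply: smooth_near_pair; [exact: fs | exact: gs].
by rewrite /chart_map2 /= !chart_toK //; apply: hs.
Qed.

Lemma smooth2_fst m n p (M : manifoldType R m) (N : manifoldType R n)
    (P : manifoldType R p) (f : M -> P) :
  smooth f -> smooth2 (fun (x : M) (_ : N) => f x).
Proof.
move=> /smoothP[fc fs]; apply/smooth2P; split.
  move=> z; apply: (@continuous_comp _ _ _ fst f); first exact: cvg_fst.
  exact: fc.
move=> x y c d k ac ad ak cx dy kx.
apply: (@smooth_near_comp _ _ _ _ fst (chart_map c k f) _ _ (findim_rV _)
  erefl).
  exact: smooth_near_fst.
exact: fs.
Qed.

(** The three charts are arbitrary: besides the chain rule for tangent maps,
    this covers the changes of chart in the definition of
    [field_in_chart]. *)
Lemma diff_chart_map_comp m n p (M : manifoldType R m) (N : manifoldType R n)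
    (P : manifoldType R p) (f : M -> N) (g : N -> P) x y z
    (c : chart R m M) (d : chart R n N) (k : chart R p P) v :
  smooth f -> smooth g -> f x = y -> g y = z ->
  atlas c -> atlas d -> atlas k ->
  chart_dom c x -> chart_dom d y -> chart_dom k z ->
  'd (chart_map c k (g \o f)) (chart_to c x) v =
  'd (chart_map d k g) (chart_to d y) ('d (chart_map c d f) (chart_to c x) v).
Proof.
move=> fS gS <- <- ac ad ak cx dx kx; have fc := smooth_cont fS.
have fd := smooth_near_is_diff (smooth_chart_map fS ac ad cx dx).
have gd := smooth_near_is_diff (smooth_chart_map gS ad ak dx kx).
have E : chart_to d (f x) = chart_map c d f (chart_to c x).
  by rewrite /chart_map /= chart_toK.
rewrite E in gd *.
have hn : \forall u \near chart_to c x,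
    (chart_map d k g \o chart_map c d f) u = chart_map c k (g \o f) u.
  apply: filterS (near_chart_from cx (near_chart_dom_comp (fc x) dx)) => u du.
  by rewrite /chart_map /= chart_toK.
by have [_ ->] := near_is_diff hn (is_diff_comp fd gd).
Qed.

Lemma near_chart_to_from n (M : topologicalType) (c : chart R n M) x :
  chart_dom c x ->
  \forall u \near chart_to c x, chart_to c (chart_from c u) = u.
Proof.
move=> cx; have : nbhs (chart_to c x) (chart_to c @` chart_dom c).
  by apply: open_nbhs_nbhs; split; [exact: chart_cod_open | exists x].
by apply: filterS => _ [y cy <-]; rewrite chart_toK.
Qed.

Lemma diff_chart_map_id n (M : topologicalType) (c : chart R n M) x v :
  chart_dom c x -> 'd (chart_map c c id) (chart_to c x) v = v.
Proof. by move=> cx; apply: near_diff_id; exact: near_chart_to_from cx. Qed.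

(** The type of [tangent_map f x v] depends on [f x], but all these types
    unfold to row vectors: equations between tangent vectors based at points
    that are only provably equal are stated at the type of row vectors. *)
Lemma tangent_mapE m n (M : manifoldType R m) (N : manifoldType R n)
    (f : M -> N) x y v : f x = y ->
  tangent_map f x v =
  'd (chart_map (chart_at x) (chart_at y) f) (chart_to (chart_at x) x) v
  :> 'rV[R]_n.
Proof. by move=> <-. Qed.

Lemma tangent_map_id n (M : manifoldType R n) (x : M) (v : 'rV[R]_n) :
  tangent_map id x v = v :> 'rV[R]_n.
Proof. exact: diff_chart_map_id v (chart_at_dom x). Qed.

Lemma tangent_map_comp m n p (M : manifoldType R m) (N : manifoldType R n)
    (P : manifoldType R p) (f : M -> N) (g : N -> P) x y v :
  smooth f -> smooth g -> f x = y ->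
  tangent_map (g \o f) x v = tangent_map g y (tangent_map f x v) :> 'rV[R]_p.
Proof.
move=> fS gS <-; apply: (diff_chart_map_comp v fS gS erefl erefl);
  by [exact: chart_at_atlas | exact: chart_at_dom].
Qed.

Lemma tangent_map_linear m n (M : manifoldType R m) (N : manifoldType R n)
  (f : M -> N) x : linear (tangent_map f x : 'rV[R]_m -> 'rV[R]_n).
Proof. exact: linearP. Qed.

End Charts.

(** * The isotropy representation at a fixed point *)

Section FixedPoint.
Context {R : realType} {n p : nat}.
Context {G : lieGroupType R n} {X : manifoldType R p}.
Variables (act : G -> X -> X) (e : X).
Hypotheses (actS : smooth_action act) (act_e : forall g, act g e = e).

Local Notation c1 := (chart_at (1%g : G)).
Local Notation u0 := (chart_to c1 1%g).
Local Notation ce := (chart_at e).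
Local Notation x0 := (chart_to ce e).

Let a1 : atlas c1. Proof. exact: chart_at_atlas. Qed.
Let d1 : chart_dom c1 1%g. Proof. exact: chart_at_dom. Qed.
Let ae : atlas ce. Proof. exact: chart_at_atlas. Qed.
Let de : chart_dom ce e. Proof. exact: chart_at_dom. Qed.

(** The vector [T_e L_g v], as a function of the coordinates [u] of [g] around
    the unit. *)
Definition chart_tangent (v : 'rV[R]_p) (u : 'rV[R]_n) : 'rV[R]_p :=
  'd (fun w => chart_map2 c1 ce ce act (u, w)) x0 v.

Local Notation T := chart_tangent.

Lemma chart_tangentE v u :
  tangent_map (act (chart_from c1 u)) e v = T v u :> 'rV[R]_p.
Proof. exact: (tangent_mapE _ (act_e _)). Qed.

Lemma tangent_actionE a v : tangent_action act e a v = 'd (T v) u0 a.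
Proof.
have E : (fun u => tangent_map (act (chart_from c1 u)) e v : 'rV[R]_p) = T v.
  by apply/funext => u; exact: chart_tangentE.
exact: (f_equal (fun f : 'rV[R]_n -> 'rV[R]_p => 'd f u0 a) E).
Qed.

Lemma smooth_chart_tangent v : smooth_near (T v) u0.
Proof.
apply: smooth_near_partial2; [exact: findim_rV | exact: findim_rV |].
have /smooth2P[_] := smooth_act actS; apply => //.
by rewrite act_e.
Qed.

Lemma tangent_map_actM g h v : tangent_map (act (g * h)%g) e v =
  tangent_map (act g) e (tangent_map (act h) e v) :> 'rV[R]_p.
Proof.
have Sg k : smooth (act k) := smooth2_slicer k (smooth_act actS).
have E : act (g * h)%g = act g \o act h.
  by apply/funext => x; rewrite (actMx actS).
apply: etrans (tangent_map_comp v (Sg h) (Sg g) (act_e h)).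
exact: (f_equal (fun f : X -> X => tangent_map f e v : 'rV[R]_p) E).
Qed.

Lemma tangent_action_linearl v : linear (tangent_action act e ^~ v).
Proof. by move=> r a b; rewrite !tangent_actionE linearP. Qed.

Lemma tangent_action_linearr a : linear (tangent_action act e a).
Proof.
move=> r v w; rewrite !tangent_actionE.
have Td v' := smooth_near_is_diff (smooth_chart_tangent v').
have [_ D] := is_diffD (is_diffZ r (Td v)) (Td w).
have E : T (r *: v + w) = r *: T v + T w.
  apply/funext => u.
  exact: (linearP ('d (fun z => chart_map2 c1 ce ce act (u, z)) x0) r v w).
exact: etrans (f_equal (fun f : 'rV[R]_n -> 'rV[R]_p => 'd f u0 a) E)
  (f_equal (fun h => h a) D).
Qed.

(** The parameter [s] lives in an arbitrary normed space: this gives both the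
    derivative along a curve in [G] and the differential of [T_e L] pulled
    back to another manifold. *)
Lemma is_diff_tangent_map (E : normedModType R) (g : E -> G) s v :
  g s = 1%g -> {for s, continuous g} -> differentiable (chart_to c1 \o g) s ->
  is_diff s (fun t => tangent_map (act (g t)) e v : 'rV[R]_p)
    (fun x => tangent_action act e ('d (chart_to c1 \o g) s x) v).
Proof.
move=> gs gc gd.
have Td := smooth_near_is_diff (smooth_chart_tangent v).
have gu : (chart_to c1 \o g) s = u0 by rewrite /= gs.
have K := is_diff_comp_at (differentiableP gd) gu Td.
have nE : \forall t \near s, (T v \o (chart_to c1 \o g)) t =
    tangent_map (act (g t)) e v.
  have nd : \forall t \near s, chart_dom c1 (g t).
    by apply: near_chart_dom_comp => //; rewrite gs.
  apply: filterS nd => t gt.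
  have H1 := chart_tangentE v (chart_to c1 (g t)).
  have H2 := f_equal (fun h => tangent_map (act h) e v : 'rV[R]_p)
    (chart_toK gt).
  have H3 := etrans (esym H1) H2.
  exact H3.
have dE : 'd (T v) u0 \o 'd (chart_to c1 \o g) s =
    (fun x => tangent_action act e ('d (chart_to c1 \o g) s x) v : 'rV[R]_p).
  by apply/funext => x; apply/esym; exact: tangent_actionE.
rewrite -dE; exact: near_is_diff nE K.
Qed.

End FixedPoint.

(** * The Lie bracket in the chart at the unit *)

Section LieGroup.
Context {R : realType} {n : nat}.
Variable G : lieGroupType R n.

Local Notation c1 := (chart_at (1%g : G)).
Local Notation u0 := (chart_to c1 1%g).

Definition chart_mul : 'rV[R]_n * 'rV[R]_n -> 'rV[R]_n :=
  chart_map2 c1 c1 c1 (fun x y : G => (x * y)%g).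

(** The left invariant field through [a], read in the chart at the unit. *)
Definition chart_left_field (a u : 'rV[R]_n) : 'rV[R]_n :=
  'd (fun w => chart_mul (u, w)) u0 a.

Let a1 : atlas c1. Proof. exact: chart_at_atlas. Qed.
Let d1 : chart_dom c1 1%g. Proof. exact: chart_at_dom. Qed.

Lemma smooth_chart_mul : smooth_near chart_mul (u0, u0).
Proof.
have /smooth2P[_] := @mulg_smooth R n G; apply => //.
by rewrite mulg1.
Qed.

Lemma near_chart_mul : \forall u \near (u0, u0),
  chart_from c1 (chart_mul u) = (chart_from c1 u.1 * chart_from c1 u.2)%g.
Proof.
have mc : {for (1%g : G, 1%g : G), continuous (fun z : G * G => (z.1 * z.2)%g)}.
  by have [mc _] := @mulg_smooth R n G; exact: mc.
have dm : chart_dom c1 ((fun z : G * G => (z.1 * z.2)%g) (1%g, 1%g)).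
  by rewrite /= mulg1.
apply: filterS (near_chart_from2 d1 d1 (near_chart_dom_comp mc dm)) => u du.
exact: chart_toK.
Qed.

Lemma near_chart_mulr1 : \forall u \near u0, chart_mul (u, u0) = u.
Proof.
apply: filterS (near_chart_to_from d1) => u uE.
by rewrite /chart_mul /chart_map2 /= (chart_toK d1) mulg1.
Qed.

Lemma near_chart_mul1r : \forall u \near u0, chart_mul (u0, u) = u.
Proof.
apply: filterS (near_chart_to_from d1) => u uE.
by rewrite /chart_mul /chart_map2 /= (chart_toK d1) mul1g.
Qed.

Lemma smooth_chart_left_field a : smooth_near (chart_left_field a) u0.
Proof.
apply: smooth_near_partial2; [exact: findim_rV | exact: findim_rV |].
exact: smooth_chart_mul.
Qed.

Lemma chart_left_field1 a : chart_left_field a u0 = a.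
Proof. exact: near_diff_id near_chart_mul1r. Qed.

Lemma smooth_mull (g : G) : smooth (fun h : G => (g * h)%g).
Proof. exact: smooth2_slicer (@mulg_smooth R n G). Qed.

Lemma smooth_mulr (g : G) : smooth (fun h : G => (h * g)%g).
Proof. exact: (smooth2_slicel g (@mulg_smooth R n G)). Qed.

(** By the chain rule, moving the vector [T L_y a] from the preferred chart at
    [y] to the one at the unit gives the differential of [h |-> y h] in the
    latter chart at both ends. *)
Lemma near_field_in_chart (a : 'rV[R]_n) : \forall u \near u0,
  chart_left_field a u =
  field_in_chart (@left_invariant_field R n G a) 1%g u.
Proof.
apply: filterS (near_chart_from d1 (near_chart_dom d1)) => u du.
rewrite /field_in_chart /left_invariant_field; set y := chart_from c1 u.
have ay : atlas (chart_at y) := chart_at_atlas _.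
have dy : chart_dom (chart_at y) y := chart_at_dom _.
have H1 := tangent_mapE a (mulg1 y : (fun h : G => (y * h)%g) 1%g = y).
have H2 :=
  f_equal ('d (chart_map (chart_at y) c1 id) (chart_to (chart_at y) y)) H1.
apply: etrans (esym H2).
exact: (diff_chart_map_comp a (smooth_mull y) (smooth_id G) (mulg1 y) (erefl y)
  a1 ay a1 d1 dy du).
Qed.

Lemma lie_bracketE (a b : 'rV[R]_n) : lie_bracket G a b =
  'd (chart_left_field b) u0 a - 'd (chart_left_field a) u0 b :> 'rV[R]_n.
Proof.
rewrite /lie_bracket /vector_field_bracket.
have E x := near_field_in_chart x.
have D x :=
  near_diff (E x) (smooth_near_differentiable (smooth_chart_left_field x)).
have V x : field_in_chart (@left_invariant_field R n G x) 1%g u0 = x.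
  by rewrite -(nbhs_singleton (E x)) chart_left_field1.
have Da := f_equal (fun h => h b) (D a).
have Db := f_equal (fun h => h a) (D b).
rewrite !V.
exact: (f_equal2 (fun x y : 'rV[R]_n => x - y) Db Da).
Qed.

End LieGroup.

(** * The bracket acts by commutators *)

Section Module.
Context {R : realType} {n p : nat}.
Context {G : lieGroupType R n} {X : manifoldType R p}.
Variables (act : G -> X -> X) (e : X).
Hypotheses (actS : smooth_action act) (act_e : forall g, act g e = e).

Local Notation c1 := (chart_at (1%g : G)).
Local Notation u0 := (chart_to c1 1%g).
Local Notation ce := (chart_at e).
Local Notation x0 := (chart_to ce e).

Lemma chart_tangentM v : \forall u \near (u0, u0),
  chart_tangent act e v (chart_mul G u) =
  chart_tangent act e (chart_tangent act e v u.2) u.1.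
Proof.
apply: filterS (near_chart_mul G) => u uE.
have H := tangent_map_actM actS act_e (chart_from c1 u.1) (chart_from c1 u.2) v.
have E1 := chart_tangentE act_e v (chart_mul G u).
rewrite uE in E1.
have E2 := chart_tangentE act_e v u.2.
have E3 := chart_tangentE act_e (chart_tangent act e v u.2) u.1.
have E4 := f_equal (fun w : 'rV[R]_p =>
  tangent_map (act (chart_from c1 u.1)) e w : 'rV[R]_p) E2.
exact: etrans (esym E1) (etrans H (etrans E4 E3)).
Qed.

(** The identity [T (g h) = T g \o T h] differentiated in [h] at the unit: the
    derivative of [T] along the left invariant field of [b], at [g], is [T g]
    applied to the action of [b]. *)
Lemma near_diff_chart_tangent b v : \forall u \near u0,
  'd (chart_tangent act e v) u (chart_left_field G b u) =
  chart_tangent act e (tangent_action act e b v) u.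
Proof.
have Ts w := smooth_chart_tangent actS act_e w.
have H1 := near_prod_curry (chart_tangentM v).
have H2 := near_chart_mulr1 G.
have H3 := smooth_near_nbhs (Ts v).
have H4 := near_prod_curry (smooth_near_nbhs (smooth_chart_mul G)).
have F := nbhs_filter u0.
have H := @filterI _ _ F _ _ (@filterI _ _ F _ _ H1 H2)
  (@filterI _ _ F _ _ H3 H4).
apply: (@filterS _ _ F _ _ _ H) => u [[HM uE] [Tu ms]].
have mu : smooth_near (chart_mul G) (u, u0) := nbhs_singleton ms.
have md : differentiable (fun w => chart_mul G (u, w)) u0.
  by have [] := is_diff_comp (is_diff_pair2 u u0)
    (smooth_near_is_diff mu).
have K1 := is_diff_comp_at (differentiableP md) uE
  (smooth_near_is_diff Tu).
pose L : {linear 'rV[R]_p -> 'rV[R]_p} :=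
  'd (fun w => chart_map2 c1 ce ce act (u, w)) x0.
have Ld := linear_rV_is_diff L (chart_tangent act e v u0).
have K2 := is_diff_comp (smooth_near_is_diff (Ts v)) Ld.
have [_ K3] := near_is_diff HM K1.
have [_ K4] := K2.
have K5 := f_equal (fun h => h b) (etrans (esym K3) K4).
apply: etrans K5 _.
exact: (f_equal L (esym (tangent_actionE act_e b v))).
Qed.

(** The preceding identity differentiated in [g] at the unit. The first term
    comes from the variation of the derivative of [T], the second one from
    that of the left invariant field. *)
Lemma tangent_action_second_order (a b : 'rV[R]_n) (v : 'rV[R]_p) :
  'd (fun u => 'd (chart_tangent act e v) u b) u0 a +
  tangent_action act e ('d (chart_left_field G b) u0 a) v =
  tangent_action act e a (tangent_action act e b v) :> 'rV[R]_p.
Proof.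
have Ts w := smooth_chart_tangent actS act_e w.
have dT w : differentiable (fun u => 'd (chart_tangent act e v) u w) u0.
  exact/smooth_near_differentiable/smooth_near_diff.
have dl := smooth_near_differentiable (smooth_chart_left_field G b).
have K := is_diff_family dT dl.
rewrite chart_left_field1 in K.
have [_ D] := near_is_diff (near_diff_chart_tangent b v) K.
have Da := f_equal (fun h => h a) D.
have E1 := tangent_actionE act_e a (tangent_action act e b v).
have E2 := tangent_actionE act_e ('d (chart_left_field G b) u0 a) v.
apply: etrans (etrans (esym Da) (esym E1)).
exact: (f_equal (fun w : 'rV[R]_p => _ + w) E2).
Qed.

(** Exchanging [a] and [b] in the preceding identity and subtracting, the second
    derivatives of [T] cancel by symmetry, and the derivatives of the left
    invariant fields combine into their bracket. *)
Lemma tangent_action_br (a b : 'rV[R]_n) (v : 'rV[R]_p) :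
  tangent_action act e (lie_bracket G a b) v =
  tangent_action act e a (tangent_action act e b v) -
  tangent_action act e b (tangent_action act e a v) :> 'rV[R]_p.
Proof.
have Ts w := smooth_chart_tangent actS act_e w.
have Hab := tangent_action_second_order a b v.
have Hba := tangent_action_second_order b a v.
have S := schwarz a b (Ts v).
have E : tangent_action act e (lie_bracket G a b) v =
    tangent_action act e ('d (chart_left_field G b) u0 a) v -
    tangent_action act e ('d (chart_left_field G a) u0 b) v :> 'rV[R]_p.
  have E1 := tangent_actionE act_e ('d (chart_left_field G b) u0 a) v.
  have E2 := tangent_actionE act_e ('d (chart_left_field G a) u0 b) v.
  have E3 := tangent_actionE act_e (lie_bracket G a b) v.
  have E4 := f_equal ('d (chart_tangent act e v) u0) (lie_bracketE G a b).
  have E5 := linearB ('d (chart_tangent act e v) u0)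
    ('d (chart_left_field G b) u0 a) ('d (chart_left_field G a) u0 b).
  have E6 := f_equal2 (fun s t : 'rV[R]_p => s - t) E1 E2.
  exact: etrans E3 (etrans E4 (etrans E5 (esym E6))).
apply: (etrans E).
set x := tangent_action _ _ ('d _ _ _) v in Hab *.
set y := tangent_action _ _ ('d _ _ _) v in Hba *.
have add_sub (w w' z z' : 'rV[R]_p) : w = w' -> z - z' = (w + z) - (w' + z').
  by move=> ->; rewrite opprD addrACA subrr add0r.
have H := add_sub _ _ x y (esym S).
apply: (etrans H).
exact: (f_equal2 (fun s t : 'rV[R]_p => s - t) Hab Hba).
Qed.

End Module.

(** * The adjoint representation *)

Section Adjoint.
Context {R : realType} {n : nat}.
Variable G : lieGroupType R n.

Local Notation c1 := (chart_at (1%g : G)).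
Local Notation u0 := (chart_to c1 1%g).

Definition conj_act (g h : G) : G := (g * h * g^-1)%g.

Let a1 : atlas c1. Proof. exact: chart_at_atlas. Qed.
Let d1 : chart_dom c1 1%g. Proof. exact: chart_at_dom. Qed.

Lemma conj_act1 g : conj_act g 1%g = 1%g.
Proof. by rewrite /conj_act mulg1 mulgV. Qed.

Lemma smooth_action_conj : smooth_action conj_act.
Proof.
split.
- apply: (@smooth2_comp _ _ _ _ _ _ _ _ _ _ _ (fun g h : G => (g * h)%g)
      (fun g _ => (g^-1)%g) (fun g h : G => (g * h)%g)).
  + exact: mulg_smooth.
  + exact: smooth2_fst (@invg_smooth R n G).
  + exact: mulg_smooth.
- by move=> x; rewrite /conj_act invg1 mulg1 mul1g.
- by move=> g h x; rewrite /conj_act invgM !mulgA.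
Qed.

(** The differential at the unit of [h |-> g h = (g h g^-1) g]. *)
Lemma tangent_map_conj g (b : 'rV[R]_n) : chart_dom c1 g ->
  'd (chart_map c1 c1 (fun h : G => (h * g)%g)) u0
    ('d (chart_map c1 c1 (conj_act g)) u0 b) =
  'd (chart_map c1 c1 (fun h : G => (g * h)%g)) u0 b.
Proof.
move=> dg.
have Sg : smooth (conj_act g) :=
  smooth2_slicer g (smooth_act smooth_action_conj).
have E : (fun h : G => (g * h)%g) = (fun h : G => (h * g)%g) \o conj_act g.
  by apply/funext => h; rewrite /conj_act /= mulgVK.
rewrite E; apply/esym.
exact: diff_chart_map_comp b Sg (smooth_mulr g) (conj_act1 g) (mul1g g)
  a1 a1 a1 d1 d1 dg.
Qed.

Lemma near_adjoint (b : 'rV[R]_n) : \forall u \near u0,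
  'd (fun w => chart_mul G (w, u)) u0 (chart_tangent conj_act 1%g b u) =
  chart_left_field G b u.
Proof.
apply: filterS (near_chart_from d1 (near_chart_dom d1)) => u du.
exact: tangent_map_conj b du.
Qed.

Lemma chart_tangent_conj1 (b : 'rV[R]_n) : chart_tangent conj_act 1%g b u0 = b.
Proof.
have E : conj_act 1%g = id.
  by apply/funext => x; rewrite (act1x smooth_action_conj).
have K : chart_map c1 c1 (conj_act (chart_from c1 u0)) = chart_map c1 c1 id.
  by rewrite (chart_toK d1) E.
apply: etrans (f_equal (fun f => 'd f u0 b) K) _.
exact: diff_chart_map_id b d1.
Qed.

(** Let [Ad g], [T R_g] and [T L_g] be the tangent maps at the unit of the
    conjugation and of the translations by [g]. The identity
    [T R_g (Ad g b) = T L_g b] is differentiated in [g] at the unit, in the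
    direction [a]: the derivative of [Ad g b] is the action of [a] on [b], and
    that of [T R_g b] is the derivative in the direction [b] of the left
    invariant field of [a], because the mixed partial derivatives of the
    multiplication commute. *)
Lemma adjoint_bracket (a b : 'rV[R]_n) :
  tangent_action conj_act 1%g a b = lie_bracket G a b :> 'rV[R]_n.
Proof.
have ms := smooth_chart_mul G.
have Ts := smooth_chart_tangent smooth_action_conj conj_act1 b.
have dT (w : 'rV[R]_n) :
    differentiable (fun u => 'd (fun w => chart_mul G (w, u)) u0 w) u0.
  apply: smooth_near_differentiable.
  by apply: smooth_near_partial1; [exact: findim_rV | exact: findim_rV |].
have K := is_diff_family dT (smooth_near_differentiable Ts).
rewrite chart_tangent_conj1 in K.
have [_ D] := near_is_diff (near_adjoint b) K.
have Da := f_equal (fun h => h a) D.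
have S := schwarz_partial b a ms.
have I := near_diff_id ('d (chart_tangent conj_act 1%g b) u0 a)
  (near_chart_mulr1 G).
have E1 := tangent_actionE conj_act1 a b.
have E2 := lie_bracketE G a b.
have gen (x y z w t : 'rV[R]_n) : z = w + t -> w = y -> t = x -> x = z - y.
  by move=> -> -> ->; rewrite addrAC subrr add0r.
apply: (etrans E1); apply: etrans (esym E2).
exact: gen Da (esym S) I.
Qed.

End Adjoint.

(** * Equivariant maps *)

Section Equivariant.
Context {R : realType} {k n1 p1 n2 p2 : nat} {H : manifoldType R k}.
Context {G1 : lieGroupType R n1} {X1 : manifoldType R p1}.
Context {G2 : lieGroupType R n2} {X2 : manifoldType R p2}.
Variables (act1 : G1 -> X1 -> X1) (act2 : G2 -> X2 -> X2) (e1 : X1) (e2 : X2).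
Hypotheses (act1S : smooth_action act1) (act_e1 : forall g, act1 g e1 = e1).
Hypotheses (act2S : smooth_action act2) (act_e2 : forall g, act2 g e2 = e2).
Variables (Phi1 : H -> G1) (Phi2 : H -> G2) (h0 : H) (Psi : X1 -> X2).
Hypotheses (Phi1S : smooth Phi1) (Phi2S : smooth Phi2) (PsiS : smooth Psi).
Hypotheses (Phi1_h0 : Phi1 h0 = 1%g) (Phi2_h0 : Phi2 h0 = 1%g).
Hypothesis Psi_e : Psi e1 = e2.
Hypothesis equivariance : forall h x,
  Psi (act1 (Phi1 h) x) = act2 (Phi2 h) (Psi x).

Local Notation ch := (chart_at h0).
Local Notation s0 := (chart_to ch h0).

Lemma tangent_map_equivariant h (v : 'rV[R]_p1) :
  tangent_map Psi e1 (tangent_map (act1 (Phi1 h)) e1 v) =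
  tangent_map (act2 (Phi2 h)) e2 (tangent_map Psi e1 v) :> 'rV[R]_p2.
Proof.
have S1 : smooth (act1 (Phi1 h)) := smooth2_slicer _ (smooth_act act1S).
have S2 : smooth (act2 (Phi2 h)) := smooth2_slicer _ (smooth_act act2S).
have E : Psi \o act1 (Phi1 h) = act2 (Phi2 h) \o Psi.
  by apply/funext => x; exact: equivariance.
have K1 := tangent_map_comp v S1 PsiS (act_e1 _).
have K2 := tangent_map_comp v PsiS S2 Psi_e.
have K := f_equal (fun f : X1 -> X2 => tangent_map f e1 v : 'rV[R]_p2) E.
exact: etrans (esym K1) (etrans K K2).
Qed.

Lemma is_diff_tangent_map_comp n p (G : lieGroupType R n) (X : manifoldType R p)
    (act : G -> X -> X) e (Phi : H -> G) (v : 'rV[R]_p) :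
  smooth_action act -> (forall g, act g e = e) -> smooth Phi -> Phi h0 = 1%g ->
  is_diff s0 (fun s => tangent_map (act (Phi (chart_from ch s))) e v : 'rV[R]_p)
    (fun c => tangent_action act e (tangent_map Phi h0 c) v).
Proof.
move=> actS act_e PhiS Phi_h0.
have dh : chart_dom ch h0 := chart_at_dom _.
have ah : atlas ch := chart_at_atlas _.
have d1 : chart_dom (chart_at (1%g : G)) (Phi h0).
  by rewrite Phi_h0; exact: chart_at_dom.
have a1 : atlas (chart_at (1%g : G)) := chart_at_atlas _.
have P0 : (Phi \o chart_from ch) s0 = 1%g by rewrite /= (chart_toK dh).
have Pc : {for s0, continuous (Phi \o chart_from ch)}.
  apply: continuous_comp; last exact: (smooth_cont PhiS).
  by apply: chart_from_continuous; exists h0.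
have Pd := smooth_near_differentiable (smooth_chart_map PhiS ah a1 dh d1).
have K := is_diff_tangent_map actS act_e v P0 Pc Pd.
have E : (fun c : 'rV[R]_k =>
    tangent_action act e (tangent_map Phi h0 c) v : 'rV[R]_p) = (fun c =>
    tangent_action act e
      ('d (chart_to (chart_at 1%g) \o (Phi \o chart_from ch)) s0 c) v).
  apply/funext => c.
  exact: (f_equal (fun a : 'rV[R]_n => tangent_action act e a v : 'rV[R]_p)
    (tangent_mapE c Phi_h0)).
rewrite E; exact: K.
Qed.

(** The equivariance is differentiated first at [e1], then in [h] at [h0].
    With a mere pointed manifold of parameters [h], this applies to a Lie group
    acting on both sides as well as to a subgroup of it. *)
Lemma tangent_action_equivariant (c : 'rV[R]_k) (v : 'rV[R]_p1) :
  tangent_map Psi e1 (tangent_action act1 e1 (tangent_map Phi1 h0 c) v) =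
  tangent_action act2 e2 (tangent_map Phi2 h0 c) (tangent_map Psi e1 v)
  :> 'rV[R]_p2.
Proof.
have D1 := is_diff_tangent_map_comp v act1S act_e1 Phi1S Phi1_h0.
have D2 := is_diff_tangent_map_comp (tangent_map Psi e1 v)
  act2S act_e2 Phi2S Phi2_h0.
pose L : {linear 'rV[R]_p1 -> 'rV[R]_p2} :=
  'd (chart_map (chart_at e1) (chart_at (Psi e1)) Psi)
    (chart_to (chart_at e1) e1).
have [_ K1] := is_diff_comp D1 (linear_rV_is_diff L _).
have [_ K2] := D2.
have E :
  L \o (fun s => tangent_map (act1 (Phi1 (chart_from ch s))) e1 v) =
  (fun s => tangent_map (act2 (Phi2 (chart_from ch s))) e2
              (tangent_map Psi e1 v) : 'rV[R]_p2).
  by apply/funext => s; exact: (tangent_map_equivariant (chart_from ch s) v).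
rewrite E in K1.
exact: (f_equal (fun h => h c) (etrans (esym K1) K2)).
Qed.

End Equivariant.

(** * Smooth maps into a Lie subgroup *)

Lemma disjoint_opens_countable (T : topologicalType) (I : Type) (D : set I)
    (O : I -> set T) : @second_countable T ->
  (forall i, D i -> open (O i) /\ O i !=set0) ->
  (forall i j, D i -> D j -> O i `&` O j !=set0 -> i = j) ->
  countable D.
Proof.
move=> [B Bc [_ Bb]] Oo Od.
have [f finj] := countable_injP _ Bc.
have ch i : exists b : set T, D i -> [/\ B b, b `<=` O i & b !=set0].
  have [Di|nDi] := pselect (D i); last by exists set0.
  have [oO [x Ox]] := Oo i Di.
  have [b [Bb' bx] bO] := Bb x _ (open_nbhs_nbhs (conj oO Ox)).
  by exists b => _; split=> //; exists x.
have [b bP] := choice ch.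
apply/countable_injP; exists (f \o b) => i j /set_mem Di /set_mem Dj /= fij.
have [Bi bi [x xi]] := bP i Di; have [Bj bj _] := bP j Dj.
apply: Od => //; exists x; split; first exact: bi.
by apply: bj; rewrite -(finj (b i) (b j)) //; exact/mem_set.
Qed.

Lemma uncountable_itv (R : realType) (d : R) : 0 < d ->
  ~ countable [set t : R | `|t| < d].
Proof.
move=> d0 /countable_lebesgue_measure0.
rewrite (_ : [set t : R | `|t| < d] = `]- d, d[%classic); last first.
  by apply/seteqP; split=> t /=; rewrite in_itv /= ltr_norml.
rewrite lebesgue_measure_itv /= lte_fin gtrN // => /eqP.
by rewrite -EFinD eqe opprK addr_eq0 gt_eqF // (lt_trans _ d0) // oppr_lt0.
Qed.

Lemma diff_chart_mul (R : realType) n (G : lieGroupType R n) (a b : 'rV[R]_n) :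
  let u0 := chart_to (chart_at (1%g : G)) 1%g in
  'd (chart_mul G) (u0, u0) (a, b) = a + b.
Proof.
move=> u0.
have md := smooth_near_differentiable (smooth_chart_mul G).
have I1 := near_diff_id a (near_chart_mulr1 G).
have I2 := near_diff_id b (near_chart_mul1r G).
have D1 := etrans (esym (diff_partial1 a md)) I1.
have D2 := etrans (esym (diff_partial2 b md)) I2.
have L := linearD ('d (chart_mul G) (u0, u0)) (a, 0) (0, b).
have E : (a, 0) + (0, b) = (a, b) :> 'rV[R]_n * 'rV[R]_n.
  by congr pair; [exact: addr0 | exact: add0r].
apply: etrans (f_equal ('d (chart_mul G) (u0, u0)) (esym E)) _.
apply: (etrans L).
exact: (f_equal2 (fun s t : 'rV[R]_n => s + t) D1 D2).
Qed.

Lemma lie_group_morphism1 (R : realType) m n (G : lieGroupType R m)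
    (H : lieGroupType R n) (f : G -> H) :
  lie_group_morphism f -> f 1%g = 1%g.
Proof. by move=> [_ fm]; apply: (mulgI (f 1%g)); rewrite -fm !mulg1. Qed.

Lemma addr_scale_eq0 (F : fieldType) (V : lmodType F) (x y : V) (t : F) :
  t != 0 -> x + t *: y = 0 -> - t^-1 *: x = y.
Proof.
move=> t0 /eqP; rewrite addr_eq0 => /eqP ->.
by rewrite scalerN scaleNr opprK scalerA mulVf // scale1r.
Qed.

Section Subgroup.
Context {R : realType} {n p : nat}.
Context {G : lieGroupType R n} {X : manifoldType R p}.
Variables (H : lie_subgroup G) (Theta : X -> G) (e : X).
Hypotheses (ThetaS : smooth Theta) (Theta_e : Theta e = 1%g).
Hypothesis ThetaH : forall x, subgroup_set H (Theta x).
Variable v : 'rV[R]_p.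

Local Notation k := (subgroup_dim H).
Local Notation K := (subgroup_type H).
Local Notation iota := (@subgroup_incl _ _ _ H).
Local Notation c1 := (chart_at (1%g : G)).
Local Notation u0 := (chart_to c1 1%g).
Local Notation ck := (chart_at (1%g : K)).
Local Notation s0 := (chart_to ck 1%g).
Local Notation ce := (chart_at e).
Local Notation x0 := (chart_to ce e).

Lemma subgroup_incl1 : iota 1%g = 1%g.
Proof. exact: lie_group_morphism1 (@subgroup_incl_morphism _ _ _ H). Qed.

(** The product [iota h * Theta x], for [h] of coordinates [rsubmx w] and [x]
    on the line through [e] in the direction [v], whose parameter is the only
    entry of [lsubmx w]. *)
Let sweep (w : 'rV[R]_(1 + k)) : 'rV[R]_n :=
  chart_to c1 (iota (chart_from ck (rsubmx w)) *
               Theta (chart_from ce (x0 + lsubmx w *m v)))%g.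

(** The same map as a composite of smooth maps between normed spaces. *)
Let chart_sweep (w : 'rV[R]_(1 + k)) : 'rV[R]_n :=
  chart_mul G (chart_map ck c1 iota (rsubmx w),
             chart_map ce c1 Theta (x0 + lsubmx w *m v)).

Let w0 : 'rV[R]_(1 + k) := row_mx 0 s0.

Let a1 : atlas c1. Proof. exact: chart_at_atlas. Qed.
Let d1 : chart_dom c1 1%g. Proof. exact: chart_at_dom. Qed.
Let ak : atlas ck. Proof. exact: chart_at_atlas. Qed.
Let dk : chart_dom ck 1%g. Proof. exact: chart_at_dom. Qed.
Let ae : atlas ce. Proof. exact: chart_at_atlas. Qed.
Let de : chart_dom ce e. Proof. exact: chart_at_dom. Qed.
Let di : chart_dom c1 (iota 1%g). Proof. by rewrite subgroup_incl1. Qed.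
Let dT : chart_dom c1 (Theta e). Proof. by rewrite Theta_e. Qed.

Let iotaS : smooth iota.
Proof. by have [] := @subgroup_incl_morphism _ _ _ H. Qed.

Let line (w : 'rV[R]_(1 + k)) : 'rV[R]_p := x0 + lsubmx w *m v.

Let rsub_w0 : rsubmx w0 = s0. Proof. exact: row_mxKr. Qed.
Let line_w0 : line w0 = x0.
Proof. by rewrite /line row_mxKl mul0mx addr0. Qed.

Let L : {linear 'rV[R]_(1 + k) -> 'rV[R]_p} := mulmxr v \o lsubmx.

Let line_smooth : smooth_near line w0.
Proof.
apply: smooth_nearD; first exact: smooth_near_cst.
apply: (@smooth_near_linear _ _ _ _ L id); last exact: smooth_near_id.
exact: linear_rV_continuous.
Qed.

Let line_diff : is_diff w0 line L.
Proof.
have := is_diffD (is_diff_cst x0 w0) (linear_rV_is_diff L w0).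
by rewrite add0r.
Qed.

Let rsub_smooth : smooth_near (rsubmx : 'rV[R]_(1 + k) -> 'rV[R]_k) w0.
Proof.
apply: (@smooth_near_linear _ _ _ _ rsubmx id); last exact: smooth_near_id.
exact: continuous_rsubmx.
Qed.

Let rsub_diff : is_diff w0 (rsubmx : 'rV[R]_(1 + k) -> 'rV[R]_k) rsubmx.
Proof.
split; first exact: differentiable_rsubmx.
exact: diff_lin (@continuous_rsubmx _ _ _ _).
Qed.

Let iota_smooth : smooth_near (chart_map ck c1 iota) s0.
Proof. exact: (smooth_chart_map iotaS ak a1 dk di). Qed.

Let Theta_smooth : smooth_near (chart_map ce c1 Theta) x0.
Proof. exact: (smooth_chart_map ThetaS ae a1 de dT). Qed.

Let chart_factors w :=
  (chart_map ck c1 iota (rsubmx w), chart_map ce c1 Theta (line w)).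

Let chart_factors_w0 : chart_factors w0 = (u0, u0).
Proof.
rewrite /chart_factors rsub_w0 line_w0 /chart_map /= (chart_toK dk).
by rewrite (chart_toK de) subgroup_incl1 Theta_e.
Qed.

Let chart_sweep_smooth : smooth_near chart_sweep w0.
Proof.
apply: (@smooth_near_comp _ _ _ _ chart_factors (chart_mul G) _ _
  (findim_prod (findim_rV _) (findim_rV _)) chart_factors_w0 _
  (smooth_chart_mul G)).
apply: smooth_near_pair.
  exact: (smooth_near_comp (findim_rV _) rsub_w0 rsub_smooth iota_smooth).
exact: (smooth_near_comp (findim_rV _) line_w0 line_smooth Theta_smooth).
Qed.

Let chart_sweep_diff w : 'd chart_sweep w0 w =
  'd (chart_map ck c1 iota) s0 (rsubmx w) +
  'd (chart_map ce c1 Theta) x0 (lsubmx w *m v).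
Proof.
have D1 := is_diff_comp_at rsub_diff rsub_w0
  (smooth_near_is_diff iota_smooth).
have D2 := is_diff_comp_at line_diff line_w0
  (smooth_near_is_diff Theta_smooth).
have [_ D] := is_diff_comp_at (is_diff_pair D1 D2) chart_factors_w0
  (smooth_near_is_diff (smooth_chart_mul G)).
exact: etrans (f_equal (fun h => h w) D) (diff_chart_mul G _ _).
Qed.

Let near_chart_sweep : \forall w \near w0, chart_sweep w = sweep w.
Proof.
have n1 : \forall s \near s0, chart_dom c1 (iota (chart_from ck s)).
  have ic := smooth_cont iotaS (x := 1%g).
  exact: near_chart_from dk (near_chart_dom_comp ic di).
have n2 : \forall x \near x0, chart_dom c1 (Theta (chart_from ce x)).
  have tc := smooth_cont ThetaS (x := e).
  exact: near_chart_from de (near_chart_dom_comp tc dT).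
have rc := smooth_near_continuous rsub_smooth.
have lc := smooth_near_continuous line_smooth.
rewrite /prop_for /continuous_at rsub_w0 in rc.
rewrite /prop_for /continuous_at line_w0 in lc.
have m1 := rc _ n1; have m2 := lc _ n2.
have F := nbhs_filter w0.
apply: (@filterS _ _ F _ _ _ (@filterI _ _ F _ _ m1 m2)) => w [w1 w2].
rewrite /chart_sweep /sweep /chart_mul /chart_map2 /chart_map /=.
by rewrite (chart_toK w1) (chart_toK w2).
Qed.

Let chart_sweep_immersion : ~ subgroup_lie_algebra H (tangent_map Theta e v) ->
  forall w, 'd chart_sweep w0 w = 0 -> w = 0.
Proof.
move=> ntheta w; rewrite chart_sweep_diff => E.
pose th : {linear 'rV[R]_p -> 'rV[R]_n} := 'd (chart_map ce c1 Theta) x0.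
pose io : {linear 'rV[R]_k -> 'rV[R]_n} := 'd (chart_map ck c1 iota) s0.
have thE : tangent_map Theta e v = th v :> 'rV[R]_n.
  exact: tangent_mapE v Theta_e.
have ioE s : tangent_map iota 1%g s = io s :> 'rV[R]_n.
  exact: tangent_mapE s subgroup_incl1.
have {}E : io (rsubmx w) + lsubmx w 0 0 *: th v = 0.
  by rewrite -linearZ -mul_scalar_mx -mx11_scalar.
have t0 : lsubmx w 0 0 = 0.
  apply/eqP/negPn/negP => t0; apply: ntheta.
  exists (- (lsubmx w 0 0)^-1 *: rsubmx w); first exact: I.
  apply: etrans (ioE _) _; apply: etrans _ (esym thE).
  exact: etrans (linearZ _ _) (addr_scale_eq0 t0 E).
rewrite t0 scale0r addr0 in E.
have r0 : rsubmx w = 0.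
  have E0 := etrans E (esym (linear0 io)).
  have Et := etrans (etrans (ioE _) E0) (esym (ioE _)).
  exact: (@subgroup_incl_immersion _ _ _ H 1%g _ _ Et).
have r0' : rsubmx w = 0 :> 'rV[R]_k := r0.
have l0 : lsubmx w = 0 :> 'rV[R]_1.
  by rewrite [LHS]mx11_scalar t0; exact: raddf0.
by rewrite -[w]hsubmxK l0 r0' row_mx0.
Qed.

(** Otherwise [(h, t) |-> iota h * Theta x_t], where [x_t] runs along the line
    through [e] in the direction [v], has an injective differential at
    [(1, 0)], so it is injective for [h] in a neighbourhood [U] of the unit of
    the subgroup and [t] in an interval around 0. With [Theta x_t = iota h_t],
    the translates [U h_t] are then pairwise disjoint open sets indexed by an
    interval, although the subgroup is second countable. *)
Lemma subgroup_tangent : subgroup_lie_algebra H (tangent_map Theta e v).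
Proof.
apply: contrapT => /chart_sweep_immersion inj.
have [d' d'0 inj'] := immersion_near_injective chart_sweep_smooth inj.
have /nbhs_ballP[d'' /= d''0 sweepE] := near_chart_sweep.
pose d := Num.min d' d''.
have d0 : 0 < d by rewrite lt_min d'0.
have finj w w' : ball w0 d w -> ball w0 d w' -> sweep w = sweep w' -> w = w'.
  move=> bw bw'.
  have le' : d <= d' by rewrite ge_min lexx.
  have le'' : d <= d'' by rewrite ge_min lexx orbT.
  rewrite -(sweepE w) -?(sweepE w'); last 2 first.
  - exact: le_ball le'' _ bw'.
  - exact: le_ball le'' _ bw.
  by apply: inj'; exact: le_ball le' _ _.
have ballE t s : `|t| < d -> ball s0 d s -> ball w0 d (row_mx t%:M s).
  move=> td [_ bs]; split=> // i j; rewrite (ord1 i) /w0 !mxE.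
  case: (fintype.split j) => l; last exact: bs.
  by rewrite !mxE (ord1 l) eqxx mulr1n /ball /= sub0r normrN.
pose U := [set h : K | chart_dom ck h /\ ball s0 d (chart_to ck h)].
have Un : nbhs (1%g : K) U.
  apply: filterI; first exact: near_chart_dom dk.
  by apply: (chart_to_continuous dk); exact: nbhsx_ballx.
have hex t : exists h : K,
    iota h = Theta (chart_from ce (x0 + t%:M *m v)).
  by have [h _ hE] := ThetaH (chart_from ce (x0 + t%:M *m v)); exists h.
have [h hE] := choice hex.
pose O t := (fun g : K => (g * (h t)^-1)%g) @^-1` (U°).
apply: (uncountable_itv d0).
apply: (@disjoint_opens_countable K _ _ O).
- exact: manifold_second_countable.
- move=> t _; split.
    apply: open_comp; last exact: open_interior.
    by move=> g _; exact: (smooth_cont (smooth_mulr (h t)^-1%g)).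
  by exists (h t); rewrite /O /= mulgV.
move=> t t' td t'd [g [/interior_subset [Ud Ub] /interior_subset [Ud' Ub']]].
have fE r : `|r| < d -> U (g * (h r)^-1)%g ->
    sweep (row_mx r%:M (chart_to ck (g * (h r)^-1)%g)) = chart_to c1 (iota g).
  move=> rd [Ur _]; rewrite /sweep row_mxKr row_mxKl (chart_toK Ur) -hE.
  have [_ im] := @subgroup_incl_morphism _ _ _ H.
  by rewrite -im mulgVK.
have := finj _ _ (ballE t _ td Ub) (ballE t' _ t'd Ub').
rewrite !fE // => /(_ erefl) /eq_row_mx[+ _].
by move=> /matrixP /(_ 0 0); rewrite !mxE eqxx !mulr1n.
Qed.

End Subgroup.

(** * The tangent relaxed augmented Leibniz algebra *)

Section Tangent.
Context {R : realType}.

Lemma tangent_action_curve n p (G : lieGroupType R n) (X : manifoldType R p)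
    (act : G -> X -> X) e (a : 'rV[R]_n) (v : 'rV[R]_p) (c : R -> G) :
  smooth_action act -> (forall g, act g e = e) ->
  smooth_curve_on `]-1, 1[ c -> c 0 = 1%g -> velocity c 0 = a ->
  is_derive (0 : R) (1 : R)
    (fun t : R => tangent_map (act (c t)) e v : 'rV[R]_p)
    (tangent_action act e a v).
Proof.
move=> actS act_e [cc cs] c0 va.
have I0 : `]-1, 1[%classic (0 : R) by rewrite /= in_itv /= ltrN10 ltr01.
pose c1 := chart_at (1%g : G).
have a1 : atlas c1 := chart_at_atlas _.
have cd : differentiable (chart_to c1 \o c : R^o -> 'rV[R]_n) 0.
  have [D _] := cs c1 a1 1%N; apply: D; split=> //=.
  by rewrite c0; exact: chart_at_dom.
have [Kd KE] := is_diff_tangent_map (E := R^o) actS act_e v c0 (cc 0 I0) cd.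
have vE : 'd (chart_to c1 \o c : R^o -> 'rV[R]_n) 0 1 = a.
  by rewrite -va /velocity c0 derive1E deriveE.
apply: DeriveDef; first exact: diff_derivable.
rewrite deriveE //; apply: etrans (f_equal (fun h => h 1) KE) _.
exact: (f_equal (fun b : 'rV[R]_n => tangent_action act e b v : 'rV[R]_p) vE).
Qed.

Lemma linear_zero (V W : lmodType R) (f : V -> W) : linear f -> f 0 = 0.
Proof.
move=> flin; have := flin 1 0 0; rewrite !scale1r addr0 => /eqP.
by rewrite -subr_eq subrr => /eqP.
Qed.

Lemma linear_opp (V W : lmodType R) (f : V -> W) : linear f ->
  forall x, f (- x) = - f x.
Proof.
move=> flin x; have := flin (-1) x 0.
by rewrite (linear_zero flin) !addr0 !scaleN1r.
Qed.

Lemma jacobi_of_derivation (V : zmodType) (br : V -> V -> V) :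
  (forall a b, br a b = - br b a) -> (forall a b, br a (- b) = - br a b) ->
  (forall a b c, br (br a b) c = br a (br b c) - br b (br a c)) ->
  forall a b c, br a (br b c) + br b (br c a) + br c (br a b) = 0.
Proof.
move=> anti brN der a b c; rewrite (anti c (br a b)) der (anti c a) brN opprB.
by rewrite addrA subrK subrr.
Qed.

(** The bracket being the adjoint action, the Jacobi identity says that
    brackets act by commutators. *)
Lemma lie_algebra_bracket n (G : lieGroupType R n) :
  is_lie_algebra (lie_bracket G).
Proof.
have S := smooth_action_conj G; have F := @conj_act1 R n G.
pose ad (a b : 'rV[R]_n) : 'rV[R]_n := tangent_action (@conj_act R n G) 1%g a b.
have E : lie_bracket G = ad :> ('rV[R]_n -> 'rV[R]_n -> 'rV[R]_n).
  by apply/funext => a; apply/funext => b; exact: esym (adjoint_bracket G a b).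
have linl b : linear (ad^~ b) := tangent_action_linearl F b.
have linr a : linear (ad a) := tangent_action_linearr S F a.
have alt (a : 'rV[R]_n) : lie_bracket G a a = 0.
  by rewrite /lie_bracket /vector_field_bracket subrr.
have der a b c : ad (ad a b) c = ad a (ad b c) - ad b (ad a c).
  apply: etrans (tangent_action_br S F a b c).
  exact: (f_equal (ad^~ c) (adjoint_bracket G a b)).
have anti a b : ad a b = - ad b a.
  have Q : lie_bracket G a b = - lie_bracket G b a :> 'rV[R]_n.
    by rewrite /lie_bracket /vector_field_bracket opprB.
  apply: etrans (adjoint_bracket G a b) (etrans Q _).
  exact: (f_equal (fun x : 'rV[R]_n => - x) (esym (adjoint_bracket G b a))).
have adN a b : ad a (- b) = - ad a b := linear_opp (linr a) b.
rewrite E; split=> //.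
  by move=> a; rewrite -E; exact: alt.
exact: jacobi_of_derivation.
Qed.

Lemma tangent_action_module n p (G : lieGroupType R n) (X : manifoldType R p)
    (act : G -> X -> X) e :
  smooth_action act -> (forall g, act g e = e) ->
  is_lie_module (lie_bracket G) (tangent_action act e).
Proof.
move=> actS act_e; split.
- exact: tangent_action_linearl.
- exact: tangent_action_linearr.
- exact: tangent_action_br.
Qed.

(** A group morphism [f] is equivariant for the conjugations through [f]
    itself. *)
Lemma lie_algebra_morphism m n (G : lieGroupType R m) (H : lieGroupType R n)
    (f : G -> H) (a b : 'rV[R]_m) : lie_group_morphism f ->
  tangent_map f 1%g (lie_bracket G a b) =
  lie_bracket H (tangent_map f 1%g a) (tangent_map f 1%g b) :> 'rV[R]_n.
Proof.
move=> fmor; have [fS fm] := fmor; have f1 := lie_group_morphism1 fmor.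
have fV x : f (x^-1)%g = ((f x)^-1)%g.
  by apply: (mulgI (f x)); rewrite -fm !mulgV.
have eqv (h x : G) : f (conj_act (id h) x) = conj_act (f h) (f x).
  by rewrite /conj_act !fm fV.
have K := tangent_action_equivariant (smooth_action_conj G) (@conj_act1 R m G)
  (smooth_action_conj H) (@conj_act1 R n H) (smooth_id G) fS fS
  (erefl 1%g) f1 f1 eqv a b.
rewrite tangent_map_id in K.
have A1 := f_equal (fun x : 'rV[R]_m => tangent_map f 1%g x : 'rV[R]_n)
  (adjoint_bracket G a b).
have A2 := adjoint_bracket H (tangent_map f 1%g a) (tangent_map f 1%g b).
exact: etrans (esym A1) (etrans K A2).
Qed.

Lemma subgroup_lie_subalgebra n (G : lieGroupType R n) (H : lie_subgroup G) :
  is_lie_subalgebra (lie_bracket G) (subgroup_lie_algebra H).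
Proof.
pose d : 'rV[R]_(subgroup_dim H) -> 'rV[R]_n :=
  tangent_map (@subgroup_incl _ _ _ H) 1%g.
have lin : linear d by exact: tangent_map_linear.
split.
- exists (0 : 'rV[R]_(subgroup_dim H)); first exact: I.
  have Z : d 0 = 0 := linear_zero lin.
  exact Z.
- move=> r _ _ [a _ <-] [b _ <-].
  exists (r *: a + b : 'rV[R]_(subgroup_dim H)); first exact: I.
  exact: lin r a b.
- move=> _ _ [a _ <-] [b _ <-].
  exists (lie_bracket (subgroup_type H) a b); first exact: I.
  exact: lie_algebra_morphism (@subgroup_incl_morphism _ _ _ H).
Qed.

(** The equivariance of [Theta] under the subgroup, for the conjugation on the
    target, becomes that of its differential, for the adjoint action. *)
Lemma relaxed_augmented_tangent n p (G : lieGroupType R n)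
    (X : manifoldType R p) (act : G -> X -> X) (e : X) (Theta : X -> G)
    (G' : lie_subgroup G) :
  relaxed_augmented_lie_rack act e Theta G' ->
  relaxed_augmented_leibniz_algebra (lie_bracket G) (tangent_action act e)
    (tangent_map Theta e : tangent_space e -> lie_algebra G)
    (subgroup_lie_algebra G').
Proof.
move=> [actS act_e ThetaS ThetaG' Theta_e Theta_eqv].
pose K := subgroup_type G'; pose iota : K -> G := @subgroup_incl _ _ _ G'.
have iota_mor : lie_group_morphism iota := @subgroup_incl_morphism _ _ _ G'.
have [iotaS _] := iota_mor; have iota1 := lie_group_morphism1 iota_mor.
split.
- exact: lie_algebra_bracket.
- exact: tangent_action_module.
- exact: tangent_map_linear.
- exact: subgroup_lie_subalgebra.
- by move=> v; exact: subgroup_tangent.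
move=> _ v [c _ <-].
have eqv (h : K) x : Theta (act (iota h) x) = conj_act (iota h) (Theta x).
  by apply: Theta_eqv; exists h.
have Q := tangent_action_equivariant actS act_e
  (smooth_action_conj G) (@conj_act1 R n G)
  iotaS iotaS ThetaS iota1 iota1 Theta_e eqv c v.
exact: etrans Q (adjoint_bracket G _ _).
Qed.

End Tangent.

Theorem proposition15 (R : realType) :
  (forall (n p : nat) (G : lieGroupType R n) (X : manifoldType R p)
      (act : G -> X -> X) (e : X) (Theta : X -> G) (G' : lie_subgroup G),
    relaxed_augmented_lie_rack act e Theta G' ->
    (forall (a : lie_algebra G) (v : tangent_space e) (c : R -> G),
      smooth_curve_on `]-1, 1[ c -> c 0 = 1%g -> velocity c 0 = a ->
      is_derive (0 : R) (1 : R)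
        (fun t : R => tangent_map (act (c t)) e v : tangent_space e)
        (tangent_action act e a v)) /\
    relaxed_augmented_leibniz_algebra
      (lie_bracket G)
      (tangent_action act e)
      (tangent_map Theta e : tangent_space e -> lie_algebra G)
      (subgroup_lie_algebra G'))
  /\
  (forall (n1 p1 : nat) (G1 : lieGroupType R n1) (X1 : manifoldType R p1)
      (act1 : G1 -> X1 -> X1) (e1 : X1) (Theta1 : X1 -> G1)
      (G1' : lie_subgroup G1)
      (n2 p2 : nat) (G2 : lieGroupType R n2) (X2 : manifoldType R p2)
      (act2 : G2 -> X2 -> X2) (e2 : X2) (Theta2 : X2 -> G2)
      (G2' : lie_subgroup G2) (Phi : G1 -> G2) (Psi : X1 -> X2),
    relaxed_augmented_lie_rack act1 e1 Theta1 G1' ->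
    relaxed_augmented_lie_rack act2 e2 Theta2 G2' ->
    lie_group_rack_triple_morphism
      act1 (rack_of_action act1 Theta1) e1 Theta1
      act2 (rack_of_action act2 Theta2) e2 Theta2 Phi Psi ->
    let theta1 : tangent_space e1 -> lie_algebra G1 :=
      tangent_map Theta1 e1 in
    let theta2 : tangent_space e2 -> lie_algebra G2 :=
      tangent_map Theta2 e2 in
    let action1 := tangent_action act1 e1 in
    let action2 := tangent_action act2 e2 in
    let phi : lie_algebra G1 -> lie_algebra G2 :=
      tangent_map Phi 1%g in
    let psi : tangent_space e1 -> tangent_space e2 :=
      tangent_map Psi e1 in
    lie_leibniz_triple_morphism
      (lie_bracket G1) action1 (leibniz_of_action action1 theta1) theta1
      (lie_bracket G2) action2 (leibniz_of_action action2 theta2) theta2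
      phi psi).
Proof.
split=> [n p G X act e Theta G' rack|].
  split; last exact: relaxed_augmented_tangent.
  move=> a v c; have [actS act_e _ _ _ _] := rack.
  exact: tangent_action_curve.
move=> n1 p1 G1 X1 act1 e1 Theta1 G1' n2 p2 G2 X2 act2 e2 Theta2 G2' Phi Psi
  rack1 rack2 [_ _ PhiM PsiS Psie anchor eqv].
move=> theta1 theta2 action1 action2 phi psi.
have [act1S act1e T1S _ T1e _] := rack1.
have [act2S act2e T2S _ T2e _] := rack2.
have [PhiS _] := PhiM; have Phi1 := lie_group_morphism1 PhiM.
split.
- exact: relaxed_augmented_leibniz_triple (relaxed_augmented_tangent rack1).
- exact: relaxed_augmented_leibniz_triple (relaxed_augmented_tangent rack2).
- exact: tangent_map_linear.
- by move=> a b; exact: lie_algebra_morphism.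
- exact: tangent_map_linear.
- move=> v; have K1 := tangent_map_comp v PsiS T2S Psie.
  have K2 := tangent_map_comp v T1S PhiS T1e.
  have E : Theta2 \o Psi = Phi \o Theta1 by apply/funext => x; exact: anchor.
  have K := f_equal (fun f : X1 -> G2 => tangent_map f e1 v : 'rV[R]_n2) E.
  exact: etrans (esym K1) (etrans K K2).
- move=> a v.
  have K := tangent_action_equivariant act1S act1e act2S act2e (smooth_id G1)
    PhiS PsiS (erefl 1%g) Phi1 Psie eqv a v.
  by rewrite tangent_map_id in K; exact: K.
Qed.
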